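(* Let $m_r(n)=E[(X_n-c_n)^r]$ be the $r$-th moment about the mean of the number $X_n$ of comparisons performed by Quicksort on a random list of length $n$. The scaled eighth moment satisfies $$\begin{aligned}\lim_{n\to\infty}\frac{m_8(n)}{m_2(n)^{4}}={}&\frac1{14883750}\left(7-\tfrac23\pi^2\right)^{-4}\Big(90558126238639-7640378199300\,\pi^2+69766200000\,\pi^4-5556600000\,\pi^6\\ &-354564000\,\pi^8-28353601080000\,\zeta(3)+1689206400000\,\zeta(3)\pi^2+7468070400000\,\zeta(3)^2\\ &-711244800000\,\zeta(3)^2\pi^2-12162286080000\,\zeta(5)+10241925120000\,\zeta(5)\zeta(3)\Big)\\ ={}&858.203\ldots\end{aligned}$$
   Context: Quicksort on a list $L$ of $n$ distinct entries: if $n\le 1$, return $L$ (no comparisons). Otherwise choose a pivot uniformly at random among the $n$ entries, compare it with each of the other $n-1$ entries (using $n-1$ comparisons) to split them into the list of smaller entries and the list of larger entries, and recursively sort the two lists. $X_n$ denotes the (random) total number of comparisons for a random list of length $n$. Equivalently, $X_n$ is the random variable with values in the nonnegative integers whose probability generating function $g_n(t)=\sum_k \Pr(X_n=k)t^k$ is determined by $g_0(t)=1$ and, for $n\ge1$, $g_n(t)=\frac{t^{n-1}}{n}\sum_{k=1}^n g_{k-1}(t)g_{n-k}(t)$. $c_n=E[X_n]$ is the mean, and $m_2(n)$ is the variance. $\zeta$ is the Riemann zeta function. *)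

(* Defs.v *)
(* Stdlib reals, with Coquelicot for limits and series. *)
From Stdlib Require Import Reals List Arith.
From Coquelicot Require Import Coquelicot.
Import ListNotations.
Open Scope R_scope.

(* A finitely supported probability distribution, as a list of weighted
   outcomes.  An outcome may be listed several times; its probability is then
   the sum of the corresponding weights. *)
Definition dist (A : Type) : Type := list (R * A).

Definition ret {A : Type} (a : A) : dist A := [(1, a)].

Definition bind {A B : Type} (d : dist A) (f : A -> dist B) : dist B :=
  flat_map
    (fun pa => map (fun qb => (fst pa * fst qb, snd qb)) (f (snd pa))) d.

Definition uniform {A : Type} (l : list A) : dist A :=
  map (fun a => (/ INR (length l), a)) l.

Definition expect {A : Type} (d : dist A) (f : A -> R) : R :=
  fold_right (fun pa s => fst pa * f (snd pa) + s) 0 d.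

(* All the ways of singling out one entry of a list, each paired with the list
   of the other entries. *)
Fixpoint picks {A : Type} (l : list A) : list (A * list A) :=
  match l with
  | [] => []
  | x :: l' =>
      (x, l') :: map (fun yr => (fst yr, x :: snd yr)) (picks l')
  end.

Fixpoint insertions {A : Type} (x : A) (l : list A) : list (list A) :=
  match l with
  | [] => [[x]]
  | y :: l' => (x :: y :: l') :: map (cons y) (insertions x l')
  end.

Fixpoint permutations {A : Type} (l : list A) : list (list A) :=
  match l with
  | [] => [[]]
  | x :: l' => flat_map (insertions x) (permutations l')
  end.

(* Returns the entries smaller than [p], the other entries, and the number of
   comparisons with [p] that were made. *)
Fixpoint split_by (p : nat) (l : list nat) : list nat * list nat * nat :=
  match l with
  | [] => ([], [], 0%nat)
  | x :: l' =>
      let '(small, large, c) := split_by p l' in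
      if (x <? p)%nat then (x :: small, large, S c)
      else (small, x :: large, S c)
  end.

(* Outcomes are pairs (sorted list, total number of comparisons).  The fuel
   only serves to make the recursion structural: the two recursive calls are on
   strictly shorter lists, so fuel [length l] is never exhausted on a list of
   two or more entries. *)
Fixpoint quicksort_fuel (fuel : nat) (l : list nat) : dist (list nat * nat) :=
  match fuel with
  | O => ret (l, 0%nat)
  | S fuel' =>
      if (length l <=? 1)%nat then ret (l, 0%nat)
      else
        bind (uniform (picks l)) (fun '(p, rest) =>
        let '(small, large, c) := split_by p rest in
        bind (quicksort_fuel fuel' small) (fun '(s, cs) =>
        bind (quicksort_fuel fuel' large) (fun '(g, cg) =>
        ret (s ++ p :: g, (c + cs + cg)%nat))))
  end.

Definition quicksort (l : list nat) : dist (list nat * nat) :=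
  quicksort_fuel (length l) l.

(* Only the relative order of the entries matters, so a random list of [n]
   distinct entries is a uniformly random permutation of 0, ..., n - 1. *)
Definition comparisons (n : nat) : dist nat :=
  bind (uniform (permutations (seq 0 n))) (fun l =>
  bind (quicksort l) (fun '(_, k) => ret k)).

Definition mean (n : nat) : R := expect (comparisons n) INR.

Definition central_moment (r n : nat) : R :=
  expect (comparisons n) (fun k => (INR k - mean n) ^ r).

(* The Dirichlet series of the Riemann zeta function, meaningful for s > 1. *)
Definition zeta (s : R) : R := Series (fun k => Rpower (INR (S k)) (- s)).

(* Main.v *)
Require Import Defs.
From Stdlib Require Import Reals Lra Lia List Arith Permutation QArith Qreals.
From Coquelicot Require Import Coquelicot.
Import ListNotations.
Open Scope R_scope.

(** Conditioning on the rank of the first pivot, the cost on a list depends only on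
    its length, and the moment generating function [g n] of [X_n] satisfies
    [(n + 1) g (n + 1) = e ^ (n s) * sum over k of g k * g (n - k)].  With
    [G (z) = sum over n of g n * z ^ n] this is [G' (z) = G (z e ^ s) ^ 2].
    Expanding in powers of [s] gives, for the generating function [V r] of
    [E (X_n ^ r) / r!], a linear equation [V r' = 2 V r / (1 - z) + ...] whose forcing
    term involves only earlier orders.  Every solution is a finite rational
    combination of the series [L ^ j / (1 - z) ^ a] with [L = - ln (1 - z)]: such
    series are closed under products, under [z d/dz] and under the integrations
    required.  So the first eight moments are found exactly by computing with
    rational coefficients ([solve]), and the outcome is checked against the recurrence
    ([moments_interp]).

    The combination giving [V r] has poles of order at most [r + 1], and only the terms
    with [a = r + 1] count at order [n ^ r].  The coefficients of
    [L ^ j / (1 - z) ^ (a + 1)] are, after division by [n ^ a], asymptotic to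
    combinations of those of [L ^ i / (1 - z)] ([P_asymptotic]), and the latter are
    [i!] times the elementary symmetric functions of [1, 1/2, ..., 1/n].  Newton's
    identities turn these into polynomials in the harmonic number, which grows like a
    logarithm, and in the power sums of exponents at least 2, which tend to zeta
    values.  The moments themselves grow with powers of the logarithm, so the errors
    are required to be smaller than every power of it ([negl], [approx]).  In the
    central moments the harmonic number cancels ([central_limit_8]), and what remains
    are the moments of a law whose cumulant of order [r >= 2] is a rational number plus
    [(-1) ^ (r - 1) * 2 ^ r * (r - 1)! * zeta r]; the eighth moment has no term in
    the seventh cumulant because the first one vanishes.

    The even zeta values are found by evaluating the sums of [1 / sin x ^ (2 p)] over
    the midpoints [x] of [2 ^ m] equal parts of the first quadrant, which have closed
    forms by the half-angle formulas, and by comparing [1 / sin x ^ 2] with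
    [1 / x ^ 2].  For the decimal value, [zeta 2], which yields [PI ^ 2], [zeta 3] and
    [zeta 5] are enclosed by partial sums with Euler-Maclaurin corrections; thirteen
    decimals are used because the terms of the closed form, of size [10 ^ 14],
    add up to about [4 * 10 ^ 8]. *)


(** * Expectations of finitely supported distributions *)

Definition sum_map {A : Type} (f : A -> R) (l : list A) : R :=
  fold_right (fun a s => f a + s) 0 l.

Lemma sum_map_app A (f : A -> R) l1 l2 :
  sum_map f (l1 ++ l2) = sum_map f l1 + sum_map f l2.
Proof. induction l1 as [|a l1 IH]; simpl; [|rewrite IH]; ring. Qed.

Lemma sum_map_ext A (f g : A -> R) l :
  (forall a, In a l -> f a = g a) -> sum_map f l = sum_map g l.
Proof.
  induction l as [|a l IH]; simpl; intros H; [reflexivity|].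
  now rewrite H, IH by auto.
Qed.

Lemma sum_map_map A B (h : A -> B) (f : B -> R) l :
  sum_map f (map h l) = sum_map (fun a => f (h a)) l.
Proof. induction l as [|a l IH]; simpl; [|rewrite IH]; reflexivity. Qed.

Lemma sum_map_plus A (f g : A -> R) l :
  sum_map (fun a => f a + g a) l = sum_map f l + sum_map g l.
Proof. induction l as [|a l IH]; simpl; [|rewrite IH]; ring. Qed.

Lemma sum_map_scal A c (f : A -> R) l :
  sum_map (fun a => c * f a) l = c * sum_map f l.
Proof. induction l as [|a l IH]; simpl; [|rewrite IH]; ring. Qed.

Lemma sum_map_const A c (l : list A) :
  sum_map (fun _ => c) l = INR (length l) * c.
Proof.
  induction l as [|a l IH]; [simpl; ring|].
  change (length (a :: l)) with (S (length l)).
  rewrite S_INR; simpl; rewrite IH; ring.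
Qed.

Lemma sum_map_exchange A B (F : A -> B -> R) l1 l2 :
  sum_map (fun x => sum_map (F x) l2) l1 = sum_map (fun y => sum_map (fun x => F x y) l1) l2.
Proof.
  induction l1 as [|x l1 IH]; simpl.
  - rewrite sum_map_const; ring.
  - rewrite IH, <- sum_map_plus; reflexivity.
Qed.

Lemma sum_map_perm A (f : A -> R) l1 l2 :
  Permutation l1 l2 -> sum_map f l1 = sum_map f l2.
Proof. induction 1; simpl; lra. Qed.

Lemma sum_map_seq (f : nat -> R) n :
  sum_map f (seq 0 (S n)) = sum_f_R0 f n.
Proof.
  induction n as [|n IH]; [simpl; ring|].
  rewrite seq_S, sum_map_app, IH; simpl; ring.
Qed.

Lemma expect_sum A (d : Defs.dist A) f :
  expect d f = sum_map (fun pa => fst pa * f (snd pa)) d.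
Proof. reflexivity. Qed.

Lemma expect_ret A (a : A) f : expect (ret a) f = f a.
Proof. unfold expect, ret; simpl; ring. Qed.

Lemma expect_bind A B (d : Defs.dist A) (k : A -> Defs.dist B) f :
  expect (bind d k) f = expect d (fun a => expect (k a) f).
Proof.
  rewrite !expect_sum; unfold bind.
  induction d as [|[w a] d IH]; [reflexivity|].
  simpl; rewrite sum_map_app, IH, sum_map_map; f_equal.
  rewrite expect_sum, <- sum_map_scal; apply sum_map_ext.
  intros qb _; simpl; ring.
Qed.

Lemma expect_ext A (d : Defs.dist A) f g :
  (forall a, f a = g a) -> expect d f = expect d g.
Proof.
  intros H; rewrite !expect_sum; apply sum_map_ext.
  intros pa _; now rewrite H.
Qed.

Lemma expect_plus A (d : Defs.dist A) f g :
  expect d (fun a => f a + g a) = expect d f + expect d g.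
Proof.
  rewrite !expect_sum, <- sum_map_plus; apply sum_map_ext; intros; ring.
Qed.

Lemma expect_scal A (d : Defs.dist A) c f :
  expect d (fun a => c * f a) = c * expect d f.
Proof.
  rewrite !expect_sum, <- sum_map_scal; apply sum_map_ext; intros; ring.
Qed.

Lemma expect_sum_f_R0 A (d : Defs.dist A) (F : nat -> A -> R) n :
  expect d (fun a => sum_f_R0 (fun i => F i a) n)
  = sum_f_R0 (fun i => expect d (F i)) n.
Proof.
  induction n as [|n IH]; simpl; [reflexivity|].
  now rewrite expect_plus, IH.
Qed.

Lemma expect_uniform A (l : list A) f :
  expect (uniform l) f = / INR (length l) * sum_map f l.
Proof.
  rewrite expect_sum; unfold uniform; rewrite sum_map_map, <- sum_map_scal.
  reflexivity.
Qed.

Lemma expect_uniform_const A (l : list A) f c :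
  l <> [] -> (forall a, In a l -> f a = c) -> expect (uniform l) f = c.
Proof.
  intros Hl H; rewrite expect_uniform, (sum_map_ext _ f (fun _ => c)) by auto.
  rewrite sum_map_const; field.
  destruct l; [easy|]; apply not_0_INR; simpl; lia.
Qed.

(** * Divided powers *)

(** The moments below are taken of [x ^ r / r!], for which the binomial theorem
    is a plain convolution. *)
Definition dpow (r : nat) (x : R) : R := x ^ r / INR (fact r).

Definition conv (u v : nat -> R) (n : nat) : R :=
  sum_f_R0 (fun k => u k * v (n - k)%nat) n.

Lemma dpow_0 x : dpow 0 x = 1.
Proof. unfold dpow; simpl; field. Qed.

Lemma dpow_zero r : dpow r 0 = if (r =? 0)%nat then 1 else 0.
Proof.
  destruct r; simpl; [apply dpow_0|].
  unfold dpow, Rdiv; rewrite pow_ne_zero by easy; ring.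
Qed.

Lemma dpow_plus r x y :
  dpow r (x + y) = conv (fun i => dpow i x) (fun i => dpow i y) r.
Proof.
  unfold dpow at 1, conv; rewrite binomial; unfold Rdiv; rewrite Rmult_comm.
  rewrite scal_sum; apply sum_eq; intros i Hi.
  unfold Binomial.C, dpow; field; repeat split; apply INR_fact_neq_0.
Qed.

Lemma conv_ext u u' v v' n :
  (forall k, (k <= n)%nat -> u k = u' k) -> (forall k, (k <= n)%nat -> v k = v' k) ->
  conv u v n = conv u' v' n.
Proof.
  intros Hu Hv; apply sum_eq; intros k Hk; rewrite Hu, Hv by lia; reflexivity.
Qed.

(** * The cost of quicksort depends only on the length of its input *)

Lemma split_by_filter p l :
  split_by p l =
  (filter (fun x => x <? p)%nat l, filter (fun x => negb (x <? p)%nat) l, length l).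
Proof.
  induction l as [|x l IH]; [reflexivity|].
  simpl; rewrite IH; now destruct (x <? p)%nat.
Qed.

Lemma length_filter_negb A (f : A -> bool) l :
  (length (filter f l) + length (filter (fun x => negb (f x)) l) = length l)%nat.
Proof. induction l as [|x l IH]; simpl; [|destruct (f x); simpl]; lia. Qed.

Lemma picks_fst A (l : list A) : map fst (picks l) = l.
Proof.
  induction l as [|x l IH]; [reflexivity|].
  simpl; f_equal; rewrite map_map; simpl; exact IH.
Qed.

Lemma picks_perm A (l : list A) pr :
  In pr (picks l) -> Permutation l (fst pr :: snd pr).
Proof.
  revert pr; induction l as [|x l IH]; simpl; [easy|].
  intros pr [<-|H]; [reflexivity|].
  apply in_map_iff in H as [qr [<- H]]; simpl.
  rewrite (IH _ H) at 1; apply perm_swap.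
Qed.

Definition rank (l : list nat) (x : nat) : nat :=
  length (filter (fun y => y <? x)%nat l).

Lemma rank_mono l x y : (x <= y)%nat -> (rank l x <= rank l y)%nat.
Proof.
  intros H; unfold rank; induction l as [|z l IH]; simpl; [lia|].
  destruct (z <? x)%nat eqn:E1, (z <? y)%nat eqn:E2; simpl; try lia.
  apply Nat.ltb_lt in E1; apply Nat.ltb_ge in E2; lia.
Qed.

(** Strictness comes from [x] itself, which is counted for [y] only. *)
Lemma rank_lt l x y : In x l -> (x < y)%nat -> (rank l x < rank l y)%nat.
Proof.
  intros Hx H; induction l as [|z l IH]; [easy|].
  pose proof (rank_mono l x y ltac:(lia)); unfold rank in *; simpl.
  destruct Hx as [->|Hx].
  - rewrite Nat.ltb_irrefl; apply Nat.ltb_lt in H; rewrite H; simpl; lia.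
  - specialize (IH Hx).
    destruct (z <? x)%nat eqn:E1, (z <? y)%nat eqn:E2; simpl; try lia.
    apply Nat.ltb_lt in E1; apply Nat.ltb_ge in E2; lia.
Qed.

(** Each possible number of smaller entries is attained by exactly one pivot. *)
Lemma ranks_perm l :
  NoDup l -> Permutation (map (rank l) l) (seq 0 (length l)).
Proof.
  intros Hl; apply NoDup_Permutation_bis.
  - assert (H : forall l', NoDup l' -> incl l' l -> NoDup (map (rank l) l')).
    { induction l' as [|x l' IH]; simpl; intros Hn Hi; constructor.
      - inversion Hn as [|? ? Hx Hn']; subst.
        intros H; apply in_map_iff in H as [y [E Hy]].
        assert (In x l) by (apply Hi; now left).
        assert (In y l) by (apply Hi; now right).
        destruct (lt_eq_lt_dec x y) as [[L| ->]|L]; [|easy|];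
          apply (rank_lt l) in L; auto; lia.
      - inversion Hn; subst; apply IH; [easy|].
        intros y Hy; apply Hi; now right. }
    apply H; [easy|apply incl_refl].
  - now rewrite length_map, length_seq.
  - intros k Hk; apply in_map_iff in Hk as [x [<- Hx]]; apply in_seq.
    split; [lia|]; simpl; unfold rank.
    pose proof (length_filter_negb _ (fun y => y <? x)%nat l) as E.
    assert (In x (filter (fun y => negb (y <? x)%nat) l)).
    { apply filter_In; split; [easy|]; now rewrite Nat.ltb_irrefl. }
    destruct (filter (fun y => negb (y <? x)%nat) l); [easy|]; simpl in E; lia.
Qed.

Lemma picks_rank l pr :
  In pr (picks l) ->
  length (filter (fun x => x <? fst pr)%nat (snd pr)) = rank l (fst pr).
Proof.
  intros H; apply picks_perm in H; unfold rank.
  assert (E : forall (f : nat -> bool) l1 l2, Permutation l1 l2 ->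
            length (filter f l1) = length (filter f l2)).
  { intros f l1 l2 P; induction P; simpl; try lia.
    - destruct (f x); simpl; lia.
    - destruct (f x), (f y); simpl; lia. }
  rewrite (E _ _ _ H); simpl; now rewrite Nat.ltb_irrefl.
Qed.

Lemma sum_picks (F : nat -> R) l n :
  NoDup l -> length l = S n ->
  sum_map (fun pr => F (length (filter (fun x => x <? fst pr)%nat (snd pr)))) (picks l)
  = sum_f_R0 F n.
Proof.
  intros Hl Hn.
  rewrite (sum_map_ext _ _ (fun pr => F (rank l (fst pr)))).
  2: { intros pr H; now rewrite (picks_rank l). }
  rewrite <- (sum_map_map _ _ fst (fun p => F (rank l p))), picks_fst.
  rewrite <- (sum_map_map _ _ (rank l) F), (sum_map_perm _ _ _ _ (ranks_perm l Hl)).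
  now rewrite Hn, sum_map_seq.
Qed.

Lemma length_picks A (l : list A) : length (picks l) = length l.
Proof. rewrite <- (picks_fst A l) at 2; now rewrite length_map. Qed.

(** Any array satisfying the recurrence obtained by conditioning on the rank of
    the pivot is the array of divided moments of the cost.  The bound [d] on the
    order lets the array be given for finitely many orders only. *)
Lemma quicksort_moments (a : nat -> nat -> R) (d : nat) :
  (forall r, (r <= d)%nat -> a r 0%nat = dpow r 0) ->
  (forall r n, (r <= d)%nat ->
     INR (S n) * a r (S n)
     = conv (fun l => dpow l (INR n))
            (fun m => sum_f_R0 (fun i => conv (a i) (a (m - i)%nat) n) m) r) ->
  forall fuel l r, NoDup l -> (length l <= fuel)%nat -> (r <= d)%nat ->
  expect (quicksort_fuel fuel l) (fun o => dpow r (INR (snd o))) = a r (length l).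
Proof.
  intros a0 aS.
  (* The recurrence at n = 0 only involves the initial values. *)
  assert (a1 : forall r, (r <= d)%nat -> a r 1%nat = dpow r 0).
  { intros r Hr; pose proof (aS r 0%nat Hr) as E; simpl in E.
    rewrite Rmult_1_l in E; rewrite E.
    replace (dpow r 0) with (dpow r (0 + (0 + 0))) by (f_equal; ring).
    rewrite dpow_plus; apply conv_ext; [easy|].
    intros m Hm; rewrite dpow_plus; apply sum_eq; intros i Hi.
    unfold conv; simpl; rewrite !a0 by lia; reflexivity. }
  induction fuel as [|fuel IH]; intros l r Hl Hf Hr.
  { destruct l; [|simpl in Hf; lia].
    cbn [quicksort_fuel]; rewrite expect_ret; simpl; now rewrite a0. }
  cbn [quicksort_fuel]; destruct (Nat.leb_spec (length l) 1) as [H1|H1].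
  { rewrite expect_ret; simpl.
    destruct l as [|x [|y l]]; simpl in *; [now rewrite a0|now rewrite a1|lia]. }
  destruct (length l) as [|n] eqn:En; [lia|].
  rewrite expect_bind, expect_uniform, length_picks, En.
  apply (Rmult_eq_reg_l (INR (S n))); [|apply not_0_INR; lia].
  rewrite <- Rmult_assoc, Rinv_r, Rmult_1_l by (apply not_0_INR; lia).
  rewrite aS by easy.
  transitivity (sum_map (fun pr : nat * list nat =>
     (fun k => conv (fun l => dpow l (INR n))
        (fun m => conv (fun i => a i k) (fun i => a i (n - k)%nat) m) r)
     (length (filter (fun x => x <? fst pr)%nat (snd pr)))) (picks l)).
  - apply sum_map_ext; intros [p rest] Hp; simpl fst; simpl snd.
    pose proof (picks_perm _ _ _ Hp) as P; simpl in P.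
    assert (Hrest : NoDup rest).
    { apply (Permutation_NoDup P) in Hl; now inversion Hl. }
    assert (Hlen : length rest = n).
    { apply Permutation_length in P; simpl in P; lia. }
    rewrite split_by_filter.
    pose proof (length_filter_negb _ (fun x => x <? p)%nat rest) as Hsplit.
    set (small := filter (fun x => x <? p)%nat rest) in *.
    set (large := filter (fun x => negb (x <? p)%nat) rest) in *.
    assert (Hs : NoDup small) by (now apply NoDup_filter).
    assert (Hg : NoDup large) by (now apply NoDup_filter).
    replace (n - length small)%nat with (length large) by lia.
    rewrite Hlen, expect_bind.
    (* Given the pivot, the cost is a constant plus two independent costs. *)
    transitivity (expect (quicksort_fuel fuel small) (fun o =>
      expect (quicksort_fuel fuel large) (fun o' =>
        dpow r (INR n + (INR (snd o) + INR (snd o')))))).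
    { apply expect_ext; intros [s cs]; rewrite expect_bind.
      apply expect_ext; intros [g cg]; rewrite expect_ret; simpl.
      f_equal; rewrite !plus_INR; ring. }
    transitivity (expect (quicksort_fuel fuel small) (fun o =>
      conv (fun l => dpow l (INR n)) (fun m =>
        conv (fun i => dpow i (INR (snd o))) (fun i => a i (length large)) m) r)).
    { apply expect_ext; intros o.
      erewrite expect_ext; [|intros o'; rewrite dpow_plus; reflexivity].
      unfold conv at 1; rewrite expect_sum_f_R0.
      apply sum_eq; intros j Hj; rewrite expect_scal; f_equal.
      erewrite expect_ext; [|intros o'; rewrite dpow_plus; reflexivity].
      unfold conv at 1; rewrite expect_sum_f_R0.
      apply sum_eq; intros i Hi; rewrite expect_scal, IH by (easy || lia).
      reflexivity. }
    unfold conv at 1; rewrite expect_sum_f_R0.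
    apply sum_eq; intros j Hj; rewrite expect_scal; f_equal.
    unfold conv at 1; rewrite expect_sum_f_R0.
    apply sum_eq; intros i Hi.
    erewrite expect_ext; [|intros o; rewrite Rmult_comm; reflexivity].
    rewrite expect_scal, IH by (easy || lia); ring.
  - rewrite sum_picks with (n := n)
      (F := fun k => conv (fun l => dpow l (INR n))
        (fun m => conv (fun i => a i k) (fun i => a i (n - k)%nat) m) r) by easy.
    unfold conv at 1; rewrite <- !sum_map_seq.
    erewrite sum_map_ext; [|intros k _; rewrite <- sum_map_seq; reflexivity].
    rewrite sum_map_exchange; unfold conv at 2; rewrite <- sum_map_seq; apply sum_map_ext.
    intros j _; rewrite sum_map_scal; f_equal.
    unfold conv at 1.
    erewrite sum_map_ext; [|intros k _; rewrite <- sum_map_seq; reflexivity].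
    rewrite sum_map_exchange, <- sum_map_seq; apply sum_map_ext.
    intros i _; unfold conv; now rewrite sum_map_seq.
Qed.

Lemma insertions_perm A (x : A) l l' : In l' (insertions x l) -> Permutation (x :: l) l'.
Proof.
  revert l'; induction l as [|y l IH]; simpl; intros l' [<-|H]; try easy.
  apply in_map_iff in H as [m [<- H]].
  rewrite <- (IH _ H); apply perm_swap.
Qed.

Lemma permutations_perm A (l l' : list A) : In l' (permutations l) -> Permutation l l'.
Proof.
  revert l'; induction l as [|x l IH]; simpl; intros l' H.
  { destruct H as [<-|[]]; reflexivity. }
  apply in_flat_map in H as [m [Hm H]].
  rewrite (IH _ Hm); now apply insertions_perm.
Qed.

Lemma permutations_nonempty A (l : list A) : permutations l <> [].
Proof.
  induction l as [|x l IH]; simpl; [easy|].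
  destruct (permutations l) as [|m p]; [easy|]; simpl.
  destruct m; simpl; easy.
Qed.

Lemma comparisons_moments (a : nat -> nat -> R) (d : nat) :
  (forall r, (r <= d)%nat -> a r 0%nat = dpow r 0) ->
  (forall r n, (r <= d)%nat ->
     INR (S n) * a r (S n)
     = conv (fun l => dpow l (INR n))
            (fun m => sum_f_R0 (fun i => conv (a i) (a (m - i)%nat) n) m) r) ->
  forall r n, (r <= d)%nat ->
  expect (comparisons n) (fun k => dpow r (INR k)) = a r n.
Proof.
  intros a0 aS r n Hr; unfold comparisons; rewrite expect_bind.
  apply expect_uniform_const; [apply permutations_nonempty|].
  intros l Hl; apply permutations_perm in Hl; rewrite expect_bind.
  assert (Hn : length l = n) by (rewrite <- (Permutation_length Hl); apply length_seq).
  erewrite expect_ext.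
  - unfold quicksort; rewrite (quicksort_moments a d a0 aS _ l r);
      [now rewrite Hn| |lia|easy].
    apply (Permutation_NoDup Hl), seq_NoDup.
  - intros [s k]; rewrite expect_ret; reflexivity.
Qed.

(** The binomial theorem turns raw moments into central ones. *)
Lemma central_moment_raw r n :
  central_moment r n
  = INR (fact r) *
    conv (fun i => expect (comparisons n) (fun k => dpow i (INR k)))
         (fun i => dpow i (- expect (comparisons n) (fun k => dpow 1 (INR k)))) r.
Proof.
  unfold central_moment, conv.
  erewrite sum_eq; [|intros i Hi; rewrite Rmult_comm, <- expect_scal; reflexivity].
  rewrite <- expect_sum_f_R0, <- expect_scal; apply expect_ext; intros k.
  replace (mean n) with (expect (comparisons n) (fun k => dpow 1 (INR k))).
  2: { unfold mean; apply expect_ext; intros j; unfold dpow; simpl; field. }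
  rewrite (sum_eq _ (fun i => dpow i (INR k)
     * dpow (r - i) (- expect (comparisons n) (fun k => dpow 1 (INR k)))))
    by (intros; ring).
  fold (conv (fun i => dpow i (INR k)) (fun i => dpow i
     (- expect (comparisons n) (fun k => dpow 1 (INR k)))) r).
  rewrite <- dpow_plus; unfold dpow at 2, Rminus, Rdiv.
  field; apply INR_fact_neq_0.
Qed.

(** * Powers of 1/(1-z) and log(1/(1-z)) *)

(** [P a j n] is the coefficient of [z ^ n] in [L ^ j / (1 - z) ^ a], where
    [L = - ln (1 - z)].  The recursion expresses
    [(1 - z) f' = a f + j L ^ (j - 1) / (1 - z) ^ a]. *)
Fixpoint P (a j n : nat) : R :=
  match n with
  | O => if (j =? 0)%nat then 1 else 0
  | S m => ((INR m + INR a) * P a j m + INR j * P a (pred j) m) / INR (S m)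
  end.

Lemma P_step a j n :
  INR (S n) * P a j (S n) = (INR n + INR a) * P a j n + INR j * P a (pred j) n.
Proof.
  cbn [P]; field; apply not_0_INR; lia.
Qed.

Lemma P_0 a j : P a j 0 = if (j =? 0)%nat then 1 else 0.
Proof. reflexivity. Qed.

(** [z d/dz] computed in two ways: on coefficients, and through
    [z / (1 - z) = 1 / (1 - z) - 1].  The induction uses that multiplying by [1 - z]
    lowers [a] by one. *)
Lemma P_theta a j n :
  INR n * P a j n
  = INR a * (P (S a) j n - P a j n) + INR j * (P (S a) (pred j) n - P a (pred j) n).
Proof.
  revert j; induction n as [|n IH]; intros j.
  { rewrite !P_0; simpl; ring. }
  assert (Q : forall i, P (S a) i (S n) = P (S a) i n + P a i (S n)).
  { intros i; apply (Rmult_eq_reg_l (INR (S n))); [|apply not_0_INR; lia].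
    rewrite Rmult_plus_distr_l, !P_step, S_INR; pose proof (IH i); rewrite S_INR; lra. }
  rewrite !Q, P_step; pose proof (IH j); lra.
Qed.

Lemma P_deriv a j n :
  INR (S n) * P a j (S n) = INR a * P (S a) j n + INR j * P (S a) (pred j) n.
Proof. rewrite P_step; pose proof (P_theta a j n); lra. Qed.

Lemma conv_succ u v n :
  INR (S n) * conv u v (S n)
  = conv (fun k => INR (S k) * u (S k)) v n + conv u (fun k => INR (S k) * v (S k)) n.
Proof.
  assert (E : INR (S n) * conv u v (S n)
    = sum_f_R0 (fun k => INR k * u k * v (S n - k)%nat) (S n)
      + sum_f_R0 (fun k => u k * (INR (S n - k) * v (S n - k)%nat)) (S n)).
  { unfold conv; rewrite scal_sum, <- plus_sum; apply sum_eq; intros k Hk.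
    rewrite minus_INR by easy; ring. }
  rewrite E; f_equal.
  - rewrite decomp_sum by lia; simpl pred; rewrite Rmult_0_l, Rmult_0_l, Rplus_0_l.
    reflexivity.
  - rewrite tech5, Nat.sub_diag, Rmult_0_l, Rmult_0_r, Rplus_0_r.
    apply sum_eq; intros k Hk.
    now replace (S n - k)%nat with (S (n - k)) by lia.
Qed.

Lemma conv_plus_l u u' v n :
  conv (fun k => u k + u' k) v n = conv u v n + conv u' v n.
Proof. unfold conv; rewrite <- plus_sum; apply sum_eq; intros; ring. Qed.

Lemma conv_plus_r u v v' n :
  conv u (fun k => v k + v' k) n = conv u v n + conv u v' n.
Proof. unfold conv; rewrite <- plus_sum; apply sum_eq; intros; ring. Qed.

Lemma conv_scal_l c u v n : conv (fun k => c * u k) v n = c * conv u v n.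
Proof. unfold conv; rewrite scal_sum; apply sum_eq; intros; ring. Qed.

Lemma conv_scal_r c u v n : conv u (fun k => c * v k) n = c * conv u v n.
Proof. unfold conv; rewrite scal_sum; apply sum_eq; intros; ring. Qed.

(** Both sides satisfy the first-order recursion of [P_step], by Leibniz's rule. *)
Lemma conv_P a j b l n : conv (P a j) (P b l) n = P (a + b) (j + l) n.
Proof.
  revert j l; induction n as [|n IH]; intros j l.
  { unfold conv; simpl; destruct j, l; simpl; ring. }
  apply (Rmult_eq_reg_l (INR (S n))); [|apply not_0_INR; lia].
  rewrite P_step, conv_succ.
  assert (E : conv (fun k => INR (S k) * P a j (S k)) (P b l) n
            + conv (P a j) (fun k => INR (S k) * P b l (S k)) n
    = (INR n + INR a + INR b) * conv (P a j) (P b l) n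
      + INR j * conv (P a (pred j)) (P b l) n + INR l * conv (P a j) (P b (pred l)) n).
  { unfold conv; rewrite !scal_sum, <- !plus_sum; apply sum_eq; intros k Hk.
    rewrite !P_step, minus_INR by easy; ring. }
  assert (Hl : INR j * P (a + b) (pred j + l) n = INR j * P (a + b) (pred (j + l)) n)
    by (destruct j; [simpl; ring|reflexivity]).
  assert (Hr : INR l * P (a + b) (j + pred l) n = INR l * P (a + b) (pred (j + l)) n)
    by (destruct l; [simpl; ring|now rewrite Nat.add_succ_r]).
  rewrite E, !IH, Hl, Hr, !plus_INR; ring.
Qed.

(** * Rational combinations of these series, computed with *)

(** An entry [(a, j, c)] stands for the term [c * L ^ j / (1 - z) ^ a]. *)
Definition lincomb := list (nat * nat * Q).

Definition interp_term (n : nat) (t : nat * nat * Q) : R :=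
  let '(a, j, c) := t in Q2R c * P a j n.

Definition interp (e : lincomb) (n : nat) : R := sum_map (interp_term n) e.

Definition Qnat (n : nat) : Q := inject_Z (Z.of_nat n).

Lemma Q2R_Qnat n : Q2R (Qnat n) = INR n.
Proof. unfold Q2R, Qnat; simpl; rewrite Rinv_1, Rmult_1_r, INR_IZR_INZ; reflexivity. Qed.

Lemma Q2R_Qred q : Q2R (Qred q) = Q2R q.
Proof. apply Qeq_eqR, Qred_correct. Qed.

Fixpoint add_term (a j : nat) (c : Q) (e : lincomb) : lincomb :=
  match e with
  | [] => [(a, j, c)]
  | (b, l, d) :: e' =>
      if (andb (a =? b) (j =? l))%nat then (b, l, Qred (c + d)) :: e'
      else (b, l, d) :: add_term a j c e'
  end.

Definition eadd (e1 e2 : lincomb) : lincomb :=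
  fold_right (fun '(a, j, c) e => add_term a j c e) e2 e1.

Definition escal (c : Q) (e : lincomb) : lincomb :=
  map (fun '(a, j, d) => (a, j, Qred (c * d))) e.

Definition emul (e1 e2 : lincomb) : lincomb :=
  fold_right (fun '(a, j, c) e =>
    eadd (map (fun '(b, l, d) => ((a + b)%nat, (j + l)%nat, Qred (c * d))) e2) e) [] e1.

(** The derivation [(1 - z) d/dz]. *)
Definition edelta (e : lincomb) : lincomb :=
  fold_right (fun '(a, j, c) e =>
    add_term a j (Qred (Qnat a * c)) (add_term a (pred j) (Qred (Qnat j * c)) e)) [] e.

Definition eshift (e : lincomb) : lincomb := map (fun '(a, j, c) => (S a, j, c)) e.

Definition ederiv (e : lincomb) : lincomb := eshift (edelta e).

Definition etheta (e : lincomb) : lincomb := eadd (ederiv e) (escal (-1) (edelta e)).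

Local Arguments Q2R : simpl never.
Local Arguments Qred : simpl never.
Local Arguments Qmult : simpl never.
Local Arguments Qplus : simpl never.
Local Arguments interp : simpl never.

Lemma interp_nil n : interp [] n = 0.
Proof. reflexivity. Qed.

Lemma interp_cons a j c e n : interp ((a, j, c) :: e) n = Q2R c * P a j n + interp e n.
Proof. reflexivity. Qed.

Lemma interp_add_term a j c e n :
  interp (add_term a j c e) n = Q2R c * P a j n + interp e n.
Proof.
  induction e as [|[[b l] d] e IH]; [reflexivity|].
  cbn [add_term]; destruct (Nat.eqb_spec a b) as [->|];
    [destruct (Nat.eqb_spec j l) as [->|]|]; cbn [andb];
    rewrite !interp_cons, ?IH, ?Q2R_Qred, ?Q2R_plus; ring.
Qed.

Lemma interp_eadd e1 e2 n : interp (eadd e1 e2) n = interp e1 n + interp e2 n.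
Proof.
  induction e1 as [|[[a j] c] e1 IH]; [simpl; rewrite ?interp_nil; ring|].
  simpl; rewrite interp_add_term, IH, interp_cons; ring.
Qed.

Lemma interp_escal c e n : interp (escal c e) n = Q2R c * interp e n.
Proof.
  induction e as [|[[a j] d] e IH]; [simpl; rewrite ?interp_nil; ring|].
  change (escal c ((a, j, d) :: e)) with ((a, j, Qred (c * d)) :: escal c e).
  rewrite !interp_cons, IH, Q2R_Qred, Q2R_mult; ring.
Qed.

Lemma interp_emul e1 e2 n : interp (emul e1 e2) n = conv (interp e1) (interp e2) n.
Proof.
  induction e1 as [|[[a j] c] e1 IH].
  { unfold conv; erewrite sum_eq with (Bn := fun _ => 0).
    - rewrite sum_cte; simpl; rewrite interp_nil; ring.
    - intros k Hk; rewrite interp_nil; ring. }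
  simpl; rewrite interp_eadd, IH.
  unfold conv at 2.
  erewrite (sum_eq _ (fun k => (Q2R c * P a j k + interp e1 k) * interp e2 (n - k)%nat))
    by (intros; now rewrite interp_cons).
  change (interp (map (fun '(b, l, d) => ((a + b)%nat, (j + l)%nat, Qred (c * d))) e2) n
    + conv (interp e1) (interp e2) n
    = conv (fun k => Q2R c * P a j k + interp e1 k) (interp e2) n).
  rewrite conv_plus_l, conv_scal_l; f_equal.
  clear IH; induction e2 as [|[[b l] d] e2 IH].
  { unfold conv; erewrite sum_eq with (Bn := fun _ => 0).
    - rewrite sum_cte; simpl; rewrite interp_nil; ring.
    - intros k Hk; rewrite interp_nil; ring. }
  cbn [map]; rewrite interp_cons, IH, Q2R_Qred, Q2R_mult, <- conv_P.
  replace (conv (P a j) (interp ((b, l, d) :: e2)) n)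
    with (conv (P a j) (fun k => Q2R d * P b l k + interp e2 k) n) by reflexivity.
  rewrite conv_plus_r, conv_scal_r; ring.
Qed.

Lemma eshift_cons a j c e : eshift ((a, j, c) :: e) = (S a, j, c) :: eshift e.
Proof. reflexivity. Qed.

Lemma interp_ederiv e n : interp (ederiv e) n = INR (S n) * interp e (S n).
Proof.
  assert (A : forall a j c e, interp (eshift (add_term a j c e)) n
              = Q2R c * P (S a) j n + interp (eshift e) n).
  { intros a j c; induction e0 as [|[[b l] d] e0 IH]; [reflexivity|].
    cbn [add_term]; destruct (Nat.eqb_spec a b) as [->|];
      [destruct (Nat.eqb_spec j l) as [->|]|];
      cbn [andb]; rewrite ?eshift_cons, !interp_cons, ?IH, ?Q2R_Qred, ?Q2R_plus; ring. }
  unfold ederiv; induction e as [|[[a j] c] e IH]; [simpl; rewrite ?interp_nil; ring|].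
  simpl edelta; rewrite !A, IH, interp_cons, !Q2R_Qred, !Q2R_mult, !Q2R_Qnat.
  rewrite Rmult_plus_distr_l, (Rmult_comm (Q2R c)), <- Rmult_assoc, P_deriv; ring.
Qed.

Lemma interp_edelta e n : interp (edelta e) n = INR (S n) * interp e (S n) - INR n * interp e n.
Proof.
  induction e as [|[[a j] c] e IH]; [simpl; rewrite ?interp_nil; ring|].
  simpl edelta; rewrite !interp_add_term, IH, !interp_cons, !Q2R_Qred, !Q2R_mult, !Q2R_Qnat.
  replace (INR (S n) * (Q2R c * P a j (S n) + interp e (S n)))
    with (Q2R c * (INR (S n) * P a j (S n)) + INR (S n) * interp e (S n)) by ring.
  rewrite P_step; ring.
Qed.

Lemma interp_etheta e n : interp (etheta e) n = INR n * interp e n.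
Proof.
  unfold etheta; rewrite interp_eadd, interp_escal, interp_ederiv, interp_edelta.
  unfold Q2R; simpl; lra.
Qed.

Definition is_zero (e : lincomb) : bool := forallb (fun '(a, j, c) => Qeq_bool c 0) e.

Lemma is_zero_correct e n : is_zero e = true -> interp e n = 0.
Proof.
  induction e as [|[[a j] c] e IH]; [reflexivity|].
  simpl; intros H; apply andb_prop in H as [Hc He].
  apply Qeq_bool_eq, Qeq_eqR in Hc; rewrite interp_cons, IH, Hc by easy.
  unfold Q2R; simpl; ring.
Qed.

(** The value at [z = 0]. *)
Definition const_coef (e : lincomb) : Q :=
  fold_right (fun '(a, j, c) s => if (j =? 0)%nat then Qred (c + s) else s) 0%Q e.

Lemma interp_0 e : interp e 0 = Q2R (const_coef e).
Proof.
  induction e as [|[[a j] c] e IH]; [unfold interp, Q2R; simpl; lra|].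
  rewrite interp_cons, IH, P_0; simpl.
  destruct (j =? 0)%nat; rewrite ?Q2R_Qred, ?Q2R_plus; lra.
Qed.

(** * Generating functions of the divided moments *)

Definition etheta_pow (l : nat) (e : lincomb) : lincomb := Nat.iter l etheta e.

(** The coefficient of [s ^ r] in [G (z e ^ s) ^ 2], for
    [G = sum over i of V i * s ^ i]. *)
Definition rhs (V : list lincomb) (r : nat) : lincomb :=
  fold_right (fun l e =>
    eadd (escal (1 / Qnat (fact l))
      (etheta_pow l (fold_right (fun i e' =>
         eadd (emul (nth i V []) (nth (r - l - i) V [])) e') [] (seq 0 (S (r - l)))))) e)
    [] (seq 0 (S r)).

(** A combination [p] with [(1 - z) p' = 2 p + c L ^ j / (1 - z) ^ a]: on terms with
    exponent [a] the operator is [(a - 2) + d/dL], inverted by a descending recursion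
    on [j], unless [a = 2], where one integrates in [L]. *)
Fixpoint solve_term (a j : nat) (c : Q) : lincomb :=
  if (a =? 2)%nat then [(a, S j, Qred (c / Qnat (S j)))]
  else
    let d := Qred (c / (Qnat a - 2)) in
    (a, j, d) :: match j with
                 | O => []
                 | S j' => solve_term a j' (Qred (- Qnat j * d))
                 end.

(** The equation [G_z (z, e ^ s) = G (z e ^ s, e ^ s) ^ 2] at order [s ^ r] is a
    linear equation for the new coefficient, with homogeneous solution
    [1 / (1 - z) ^ 2], whose multiple is fixed by the value at [z = 0].  As [V] ends
    before the unknown entry, which [rhs] then takes to be 0, [rhs] is the forcing
    term; [pred] divides it by [1 / (1 - z)]. *)
Definition solve (V : list lincomb) (r : nat) : lincomb :=
  let p := fold_right (fun '(a, j, c) e => eadd (solve_term (pred a) j c) e) [] (rhs V r) in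
  add_term 2 0 (Qred (- const_coef p)) p.

Fixpoint moment_gfs (r : nat) : list lincomb :=
  match r with
  | O => [[(1, 0, 1%Q)]]%nat
  | S r' => let V := moment_gfs r' in V ++ [solve V r]
  end.

(** Stored in evaluated form, so that the equation can be tested without solving it
    again. *)
Definition moment_gfs_8 : list lincomb := Eval vm_compute in moment_gfs 8.

Definition moment_gf (r : nat) : lincomb := nth r moment_gfs_8 [].

Definition check_moment_gf (r : nat) : bool :=
  andb (is_zero (eadd (ederiv (moment_gf r)) (escal (-1) (rhs moment_gfs_8 r))))
       (Qeq_bool (const_coef (moment_gf r)) (if (r =? 0)%nat then 1 else 0)).

(** Substituting the computed series into the differential equation, and comparing
    constant terms, certifies them whatever method produced them. *)
Lemma check_moment_gfs : forallb check_moment_gf (seq 0 9) = true.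
Proof. vm_cast_no_check (eq_refl true). Qed.

Lemma interp_fold_eadd A (f : A -> lincomb) l n :
  interp (fold_right (fun i e => eadd (f i) e) [] l) n = sum_map (fun i => interp (f i) n) l.
Proof. induction l as [|i l IH]; simpl; [|rewrite interp_eadd, IH]; reflexivity. Qed.

Lemma interp_etheta_pow l e n : interp (etheta_pow l e) n = INR n ^ l * interp e n.
Proof.
  unfold etheta_pow; induction l as [|l IH]; simpl; [ring|].
  rewrite interp_etheta, IH; ring.
Qed.

Lemma interp_rhs V r n :
  interp (rhs V r) n
  = conv (fun l => dpow l (INR n))
      (fun m => sum_f_R0 (fun i =>
         conv (interp (nth i V [])) (interp (nth (m - i) V [])) n) m) r.
Proof.
  unfold rhs; rewrite interp_fold_eadd; unfold conv at 1.
  rewrite <- sum_map_seq; apply sum_map_ext; intros l _.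
  rewrite interp_escal, interp_etheta_pow, interp_fold_eadd, <- sum_map_seq.
  erewrite sum_map_ext; [|intros i _; apply interp_emul].
  rewrite Q2R_div, Q2R_Qnat.
  - unfold dpow, Rdiv; change (Q2R 1) with (1 * / 1); rewrite Rinv_1; ring.
  - intros H; apply Qeq_eqR in H; rewrite Q2R_Qnat in H.
    apply (INR_fact_neq_0 l); rewrite H; unfold Q2R; simpl; ring.
Qed.

Lemma check_moment_gf_le r : (r <= 8)%nat -> check_moment_gf r = true.
Proof.
  intros Hr; pose proof check_moment_gfs as H; rewrite forallb_forall in H.
  apply H, in_seq; lia.
Qed.

(** Both sides satisfy the recurrence of [comparisons_moments], which determines them. *)
Lemma moments_interp r n :
  (r <= 8)%nat -> expect (comparisons n) (fun k => dpow r (INR k)) = interp (moment_gf r) n.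
Proof.
  apply (comparisons_moments (fun r => interp (moment_gf r)) 8); clear.
  - intros r Hr; apply check_moment_gf_le, andb_prop in Hr as [_ H].
    apply Qeq_bool_eq, Qeq_eqR in H; rewrite interp_0, H, dpow_zero.
    destruct (r =? 0)%nat; unfold Q2R; simpl; lra.
  - intros r n Hr; apply check_moment_gf_le, andb_prop in Hr as [H _].
    apply (is_zero_correct _ n) in H.
    rewrite interp_eadd, interp_escal, interp_ederiv, interp_rhs in H.
    change (Q2R (-1)) with (-1 * / 1) in H; rewrite Rinv_1 in H.
    unfold moment_gf in *; lra.
Qed.

(** * Sequences up to errors beating every power of the logarithm *)

Definition harm (n : nat) : R := P 1 1 n.

Lemma P_1_0 n : P 1 0 n = 1.
Proof.
  induction n as [|n IH]; [reflexivity|].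
  cbn [P]; rewrite IH, !S_INR; simpl INR; pose proof (pos_INR n); field; lra.
Qed.

Lemma P_1_succ j n : P 1 j (S n) = P 1 j n + INR j * P 1 (pred j) n / INR (S n).
Proof.
  cbn [P]; rewrite !S_INR; simpl INR; pose proof (pos_INR n); field; lra.
Qed.

Lemma harm_succ n : harm (S n) = harm n + / (INR n + 1).
Proof.
  unfold harm; rewrite P_1_succ; simpl pred; rewrite P_1_0, !S_INR; simpl INR.
  pose proof (pos_INR n); field; lra.
Qed.

Lemma harm_pos n : 0 <= harm n.
Proof.
  induction n as [|n IH]; [unfold harm; simpl; lra|].
  rewrite harm_succ; pose proof (pos_INR n).
  assert (0 < / (INR n + 1)) by (apply Rinv_0_lt_compat; lra); lra.
Qed.

(** From [exp (1 / (n + 1)) <= (n + 1) / n], which is [1 - x <= exp (- x)] inverted. *)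
Lemma exp_harm_le n : exp (harm n) <= exp 1 * (INR n + 1).
Proof.
  assert (E1 : 1 < exp 1) by (pose proof (exp_ineq1 1 ltac:(lra)); lra).
  assert (A : forall n, exp (harm (S n)) <= exp 1 * (INR n + 1)).
  { clear n; induction n as [|n IH].
    - rewrite harm_succ; replace (harm 0) with 0 by reflexivity; simpl INR.
      replace (0 + / (0 + 1)) with 1 by field; lra.
    - rewrite harm_succ, exp_plus, S_INR; pose proof (pos_INR n) as Hn.
      assert (X : exp (/ (INR n + 1 + 1)) <= (INR n + 1 + 1) / (INR n + 1)).
      { pose proof (exp_ineq1_le (- / (INR n + 1 + 1))) as X.
        rewrite exp_Ropp in X.
        apply Rinv_le_contravar in X.
        - rewrite Rinv_inv in X; eapply Rle_trans; [exact X|].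
          right; field; split; lra.
        - replace (1 + - / (INR n + 1 + 1)) with ((INR n + 1) / (INR n + 1 + 1))
            by (field; lra).
          apply Rdiv_lt_0_compat; lra. }
      eapply Rle_trans.
      + apply Rmult_le_compat; [left; apply exp_pos|left; apply exp_pos|exact IH|exact X].
      + right; field; lra. }
  destruct n as [|n].
  - replace (harm 0) with 0 by reflexivity; rewrite exp_0; simpl; lra.
  - eapply Rle_trans; [apply A|]; rewrite S_INR; nra.
Qed.

Lemma exp_harm_ge n : INR n + 1 <= exp (harm n).
Proof.
  induction n as [|n IH].
  - replace (harm 0) with 0 by reflexivity; rewrite exp_0; simpl; lra.
  - rewrite harm_succ, exp_plus, S_INR; pose proof (pos_INR n).
    pose proof (exp_ineq1_le (/ (INR n + 1))).
    assert (0 < / (INR n + 1)) by (apply Rinv_0_lt_compat; lra).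
    assert ((INR n + 1) * / (INR n + 1) = 1) by (field; lra); nra.
Qed.

Lemma is_lim_harm : is_lim_seq harm p_infty.
Proof.
  apply is_lim_seq_le_p_loc with (fun n => ln (INR n + 1)).
  - exists 0%nat; intros n _; pose proof (pos_INR n).
    rewrite <- (ln_exp (harm n)); apply ln_le; [lra|apply exp_harm_ge].
  - apply (is_lim_comp_seq ln _ p_infty p_infty).
    + apply is_lim_ln_p.
    + now exists 0%nat.
    + apply is_lim_seq_plus with p_infty 1.
      * apply is_lim_seq_INR.
      * apply is_lim_seq_const.
      * easy.
Qed.

(** Negligible errors: the moments carry powers of the logarithm that cancel only in
    the end, so the errors must stay small against all of them. *)
Definition negl (u : nat -> R) : Prop :=
  forall k, is_lim_seq (fun n => (1 + harm n) ^ k * u n) 0.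

Definition tame (u : nat -> R) : Prop :=
  exists k K, forall n, Rabs (u n) <= K * (1 + harm n) ^ k.

Lemma harm1_pow_ge k n : 1 <= (1 + harm n) ^ k.
Proof. apply pow_R1_Rle; pose proof (harm_pos n); lra. Qed.

(** Exponentiating, a power of [1 + x] is at most a multiple of [exp x], which at
    [x = harm n] is at most a multiple of [n + 1]. *)
Lemma negl_inv : negl (fun n => / (INR n + 1)).
Proof.
  intros k.
  set (C := INR (S k) ^ S k * exp 1).
  assert (B : forall n, (1 + harm n) ^ S k <= C * (INR n + 1)).
  { intros n; pose proof (harm_pos n) as Hn; unfold C.
    assert (Hk : 1 <= INR (S k)) by (rewrite S_INR; pose proof (pos_INR k); lra).
    assert (X : 1 + harm n <= INR (S k) * exp (harm n / INR (S k))).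
    { pose proof (exp_ineq1_le (harm n / INR (S k))) as X.
      apply Rmult_le_compat_l with (r := INR (S k)) in X; [|lra].
      replace (INR (S k) * (1 + harm n / INR (S k))) with (INR (S k) + harm n) in X
        by (field; lra); lra. }
    apply Rle_trans with ((INR (S k) * exp (harm n / INR (S k))) ^ S k).
    - apply pow_incr; lra.
    - rewrite Rpow_mult_distr, Rmult_assoc; apply Rmult_le_compat_l.
      + apply pow_le; lra.
      + assert (E : forall x m, exp x ^ m = exp (INR m * x)).
        { intros x m; induction m as [|m IH]; [simpl; now rewrite Rmult_0_l, exp_0|].
          simpl pow; rewrite IH, <- exp_plus, S_INR; f_equal; ring. }
        rewrite E; replace (INR (S k) * (harm n / INR (S k))) with (harm n)
          by (field; lra).
        apply exp_harm_le. }
  apply is_lim_seq_le_le with (u := fun _ => 0) (w := fun n => C * / (1 + harm n)).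
  - intros n; pose proof (harm_pos n); pose proof (pos_INR n).
    pose proof (harm1_pow_ge k n).
    assert (0 < / (INR n + 1)) by (apply Rinv_0_lt_compat; lra).
    split; [nra|].
    apply Rmult_le_reg_r with ((INR n + 1) * (1 + harm n)); [nra|].
    replace ((1 + harm n) ^ k * / (INR n + 1) * ((INR n + 1) * (1 + harm n)))
      with ((1 + harm n) ^ S k) by (simpl; field; lra).
    replace (C * / (1 + harm n) * ((INR n + 1) * (1 + harm n)))
      with (C * (INR n + 1)) by (field; lra).
    apply B.
  - apply is_lim_seq_const.
  - replace (Finite 0) with (Rbar_mult C 0) by (simpl; f_equal; ring).
    apply is_lim_seq_scal_l.
    replace (Finite 0) with (Rbar_inv p_infty) by reflexivity.
    apply is_lim_seq_inv; [|easy].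
    apply is_lim_seq_plus with 1 p_infty; [apply is_lim_seq_const|apply is_lim_harm|easy].
Qed.

Lemma negl_ext u v : (forall n, u n = v n) -> negl u -> negl v.
Proof.
  intros E Hu k; eapply is_lim_seq_ext; [|apply (Hu k)]; intros n; simpl; now rewrite E.
Qed.

Lemma negl_0 : negl (fun _ => 0).
Proof.
  intros k; eapply is_lim_seq_ext; [|apply is_lim_seq_const]; intros n; simpl; ring.
Qed.

Lemma negl_plus u v : negl u -> negl v -> negl (fun n => u n + v n).
Proof.
  intros Hu Hv k; eapply is_lim_seq_ext.
  2: { replace (Finite 0) with (Finite (0 + 0)) by (f_equal; ring).
       apply is_lim_seq_plus'; [apply (Hu k)|apply (Hv k)]. }
  intros n; simpl; ring.
Qed.

Lemma negl_mult u v : negl u -> negl v -> negl (fun n => u n * v n).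
Proof.
  intros Hu Hv k; eapply is_lim_seq_ext.
  2: { replace (Finite 0) with (Finite (0 * 0)) by (f_equal; ring).
       apply is_lim_seq_mult'; [apply (Hu k)|apply (Hv 0%nat)]. }
  intros n; simpl; ring.
Qed.

Lemma negl_le u v : (forall n, Rabs (u n) <= v n) -> negl v -> negl u.
Proof.
  intros H Hv k; apply is_lim_seq_abs_0.
  apply is_lim_seq_le_le with (u := fun _ => 0) (w := fun n => (1 + harm n) ^ k * v n);
    [|apply is_lim_seq_const|apply Hv].
  intros n; pose proof (harm1_pow_ge k n); split; [apply Rabs_pos|].
  rewrite Rabs_mult, (Rabs_pos_eq (_ ^ k)) by lra.
  apply Rmult_le_compat_l; [lra|apply H].
Qed.

Lemma negl_abs u : negl u -> negl (fun n => Rabs (u n)).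
Proof.
  intros H k; apply is_lim_seq_abs_0; specialize (H k); apply is_lim_seq_abs_0 in H.
  eapply is_lim_seq_ext; [|exact H]; intros n; simpl.
  now rewrite !Rabs_mult, Rabs_Rabsolu.
Qed.

Lemma negl_mult_tame u v : negl u -> tame v -> negl (fun n => u n * v n).
Proof.
  intros Hu (k' & K & Hv).
  apply negl_le with (fun n => Rabs (u n) * (K * (1 + harm n) ^ k')).
  - intros n; rewrite Rabs_mult; apply Rmult_le_compat_l; [apply Rabs_pos|apply Hv].
  - intros k; pose proof (negl_abs _ Hu (k + k')%nat) as L.
    eapply is_lim_seq_ext.
    2: { replace (Finite 0) with (Rbar_mult K 0) by (simpl; f_equal; ring).
         apply is_lim_seq_scal_l; exact L. }
    intros n; simpl; rewrite pow_add; ring.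
Qed.

Lemma tame_const c : tame (fun _ => c).
Proof. exists 0%nat, (Rabs c); intros n; simpl; lra. Qed.

Lemma tame_harm : tame harm.
Proof.
  exists 1%nat, 1; intros n; pose proof (harm_pos n).
  rewrite Rabs_pos_eq by lra; simpl; lra.
Qed.

Lemma tame_plus u v : tame u -> tame v -> tame (fun n => u n + v n).
Proof.
  intros (k & K & Hu) (l & L & Hv); exists (k + l)%nat, (K + L); intros n.
  eapply Rle_trans; [apply Rabs_triang|].
  specialize (Hu n); specialize (Hv n); pose proof (Rabs_pos (u n)); pose proof (Rabs_pos (v n)).
  pose proof (harm1_pow_ge k n); pose proof (harm1_pow_ge l n); rewrite pow_add.
  assert (0 <= K * (1 + harm n) ^ k * ((1 + harm n) ^ l - 1)) by (apply Rmult_le_pos; lra).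
  assert (0 <= L * (1 + harm n) ^ l * ((1 + harm n) ^ k - 1)) by (apply Rmult_le_pos; lra).
  lra.
Qed.

Lemma tame_mult u v : tame u -> tame v -> tame (fun n => u n * v n).
Proof.
  intros (k & K & Hu) (l & L & Hv); exists (k + l)%nat, (K * L); intros n.
  rewrite Rabs_mult, pow_add.
  replace (K * L * ((1 + harm n) ^ k * (1 + harm n) ^ l))
    with (K * (1 + harm n) ^ k * (L * (1 + harm n) ^ l)) by ring.
  apply Rmult_le_compat; auto using Rabs_pos.
Qed.

(** Demanding that the second sequence be tame makes this relation compatible
    with products. *)
Definition approx (u v : nat -> R) : Prop := negl (fun n => u n - v n) /\ tame v.

Lemma approx_ext u u' v v' :
  (forall n, u n = u' n) -> (forall n, v n = v' n) -> approx u v -> approx u' v'.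
Proof.
  intros Hu Hv [N (k & K & T)]; split.
  - eapply negl_ext; [|exact N]; intros n; simpl; now rewrite Hu, Hv.
  - exists k, K; intros n; now rewrite <- Hv.
Qed.

Lemma approx_refl u : tame u -> approx u u.
Proof. split; [|easy]; eapply negl_ext; [|apply negl_0]; intros n; simpl; ring. Qed.

Lemma approx_const c : approx (fun _ => c) (fun _ => c).
Proof. apply approx_refl, tame_const. Qed.

Lemma approx_negl u : negl u -> approx u (fun _ => 0).
Proof.
  split; [|apply tame_const]; eapply negl_ext; [|exact H]; intros n; simpl; ring.
Qed.

Lemma approx_plus u u' v v' :
  approx u u' -> approx v v' -> approx (fun n => u n + v n) (fun n => u' n + v' n).
Proof.
  intros [Nu Tu] [Nv Tv]; split; [|now apply tame_plus].
  eapply negl_ext; [|apply (negl_plus _ _ Nu Nv)]; intros n; simpl; ring.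
Qed.

Lemma approx_mult u u' v v' :
  approx u u' -> approx v v' -> approx (fun n => u n * v n) (fun n => u' n * v' n).
Proof.
  intros [Nu Tu] [Nv Tv]; split; [|now apply tame_mult].
  eapply negl_ext.
  2: { apply negl_plus; [apply negl_plus|].
       - apply (negl_mult_tame _ _ Nu Tv).
       - apply (negl_mult_tame _ _ Nv Tu).
       - apply (negl_mult _ _ Nu Nv). }
  intros n; simpl; ring.
Qed.

Lemma approx_trans u v w : approx u v -> approx v w -> approx u w.
Proof.
  intros [Nu _] [Nv Tw]; split; [|easy].
  eapply negl_ext; [|apply (negl_plus _ _ Nu Nv)]; intros n; simpl; ring.
Qed.

Lemma approx_scal c u v : approx u v -> approx (fun n => c * u n) (fun n => c * v n).
Proof. intros H; apply (approx_mult _ _ _ _ (approx_const c) H). Qed.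

Lemma approx_pow u v k : approx u v -> approx (fun n => u n ^ k) (fun n => v n ^ k).
Proof.
  intros H; induction k as [|k IH]; [apply (approx_const 1)|].
  simpl; now apply approx_mult.
Qed.

Lemma approx_sum (u v : nat -> nat -> R) m :
  (forall i, (i <= m)%nat -> approx (u i) (v i)) ->
  approx (fun n => sum_f_R0 (fun i => u i n) m) (fun n => sum_f_R0 (fun i => v i n) m).
Proof.
  induction m as [|m IH]; intros H; simpl; [apply H; lia|].
  apply approx_plus; [apply IH; intros; apply H; lia|apply H; lia].
Qed.

Lemma approx_lim u c : approx u (fun _ => c) -> is_lim_seq u c.
Proof.
  intros [N _]; specialize (N 0%nat); simpl in N.
  apply is_lim_seq_ext with (fun n => (1 * (u n - c)) + c); [intros n; ring|].
  replace (Finite c) with (Finite (0 + c)) by (f_equal; ring).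
  apply is_lim_seq_plus'; [exact N|apply is_lim_seq_const].
Qed.

(** * Leading order of the coefficients of L^j / (1-z)^(a+1) *)

Fixpoint ev (l : list Q) (f : nat -> R) : R :=
  match l with
  | [] => 0
  | c :: l' => Q2R c * f 0%nat + ev l' (fun i => f (S i))
  end.

Fixpoint ladd (l1 l2 : list Q) : list Q :=
  match l1, l2 with
  | [], _ => l2
  | _, [] => l1
  | c1 :: l1', c2 :: l2' => Qred (c1 + c2) :: ladd l1' l2'
  end.

Definition lscal (c : Q) (l : list Q) : list Q := map (fun d => Qred (c * d)) l.

Lemma ev_ladd l1 l2 f : ev (ladd l1 l2) f = ev l1 f + ev l2 f.
Proof.
  revert l2 f; induction l1 as [|c1 l1 IH]; intros [|c2 l2] f; cbn [ladd ev]; try ring.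
  rewrite IH, Q2R_Qred, Q2R_plus; ring.
Qed.

Lemma ev_lscal c l f : ev (lscal c l) f = Q2R c * ev l f.
Proof.
  revert f; induction l as [|d l IH]; intros f; cbn [lscal map ev]; [ring|].
  fold (lscal c l); rewrite IH, Q2R_Qred, Q2R_mult; ring.
Qed.

Lemma ev_unit j f : ev (repeat 0%Q j ++ [1%Q]) f = f j.
Proof.
  revert f; induction j as [|j IH]; intros f; cbn [repeat app ev].
  - unfold Q2R; simpl; field.
  - rewrite IH; unfold Q2R; simpl; field.
Qed.

Lemma approx_ev l (f g : nat -> nat -> R) :
  (forall i, approx (f i) (g i)) ->
  approx (fun n => ev l (fun i => f i n)) (fun n => ev l (fun i => g i n)).
Proof.
  revert f g; induction l as [|c l IH]; intros f g H; simpl; [apply (approx_const 0)|].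
  apply approx_plus; [apply approx_scal, H|].
  apply (IH (fun i => f (S i)) (fun i => g (S i))); intros i; apply H.
Qed.

(** Row [a], entry [j]: the coefficients, along [P 1 0, P 1 1, ...], of the
    leading order of [P (S a) j], divided by [n ^ a]. *)
Fixpoint lead (a j : nat) : list Q :=
  match a with
  | O => repeat 0%Q j ++ [1%Q]
  | S a' =>
      (fix go (j : nat) : list Q :=
         match j with
         | O => lscal (1 / Qnat (S a')) (lead a' 0)
         | S j' =>
             lscal (1 / Qnat (S a')) (ladd (lead a' (S j')) (lscal (- Qnat (S j')) (go j')))
         end) j
  end.

Lemma Q2R_inv_Qnat n : Q2R (1 / Qnat (S n)) = / INR (S n).
Proof.
  rewrite Q2R_div.
  - rewrite Q2R_Qnat; change (Q2R 1) with (1 * / 1); rewrite Rinv_1.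
    unfold Rdiv; ring.
  - intros H; apply Qeq_eqR in H; rewrite Q2R_Qnat in H.
    apply (not_0_INR (S n)); [lia|]; rewrite H; unfold Q2R; simpl; ring.
Qed.

(** By [P_theta] the leading order of [z d/dz], which multiplies coefficients by
    [n], sends [L ^ j / (1 - z) ^ (a + 1)] to
    [((a + 1) L ^ j + j L ^ (j - 1)) / (1 - z) ^ (a + 2)]; [lead] inverts this
    triangular relation. *)
Lemma P_asymptotic (tP : forall j, tame (P 1 j)) a j :
  approx (fun n => P (S a) j n / (INR n + 1) ^ a) (fun n => ev (lead a j) (fun i => P 1 i n)).
Proof.
  revert j; induction a as [|a IHa].
  { intros j; apply approx_ext with (u := P 1 j) (v := P 1 j); [| |now apply approx_refl].
    - intros n; simpl; field.
    - intros n; unfold lead; now rewrite ev_unit. }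
  assert (N1 : approx (fun n => / (INR n + 1)) (fun _ => 0)) by apply approx_negl, negl_inv.
  assert (HS : INR (S a) <> 0) by (apply not_0_INR; lia).
  induction j as [|j IHj].
  - eapply approx_ext; [| |apply (approx_scal (/ INR (S a))), approx_mult;
      [apply approx_plus; [apply (approx_const 1)|apply (approx_scal (INR a)), N1]
      |apply (IHa 0%nat)]].
    + intros n; pose proof (pos_INR n); pose proof (P_theta (S a) 0 n) as T.
      change (INR 0) with 0 in T; rewrite <- tech_pow_Rmult.
      assert (D : (INR n + 1) ^ a <> 0) by (apply pow_nonzero; lra).
      replace (P (S (S a)) 0 n) with ((INR n + INR (S a)) * P (S a) 0 n / INR (S a))
        by (apply (Rmult_eq_reg_l (INR (S a))); [|easy]; field_simplify; [lra|easy]).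
      rewrite S_INR in *; field; repeat split; try easy; lra.
    + intros n; cbn [lead]; rewrite ev_lscal, Q2R_inv_Qnat; ring.
  - eapply approx_ext; [| |apply (approx_scal (/ INR (S a))), approx_plus;
      [apply approx_plus;
        [apply approx_mult;
          [apply approx_plus; [apply (approx_const 1)|apply (approx_scal (INR a)), N1]
          |apply (IHa (S j))]
        |apply (approx_scal (INR (S j))), approx_mult; [apply N1|apply (IHa j)]]
      |apply (approx_scal (- INR (S j))), IHj]].
    + intros n; pose proof (pos_INR n); pose proof (P_theta (S a) (S j) n) as T.
      simpl pred in T; rewrite <- !tech_pow_Rmult.
      assert (D : (INR n + 1) ^ a <> 0) by (apply pow_nonzero; lra).
      replace (P (S (S a)) (S j) n) with (((INR n + INR (S a)) * P (S a) (S j) n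
          + INR (S j) * P (S a) j n - INR (S j) * P (S (S a)) j n) / INR (S a))
        by (apply (Rmult_eq_reg_l (INR (S a))); [|easy]; field_simplify; [lra|easy]).
      rewrite (S_INR a) in *; field; repeat split; try easy; lra.
    + intros n; cbn [lead]; fold (lead (S a) j).
      rewrite ev_lscal, ev_ladd, ev_lscal, Q2R_inv_Qnat, Q2R_opp, Q2R_Qnat.
      change ((fix go (j0 : nat) : list Q := match j0 with
         | 0%nat => lscal (1 / Qnat (S a)) (lead a 0)
         | S j' => lscal (1 / Qnat (S a)) (ladd (lead a (S j')) (lscal (- Qnat (S j')) (go j')))
         end) j) with (lead (S a) j).
      ring.
Qed.

(** * Powers of the logarithm and power sums *)

Fixpoint psum (i n : nat) : R :=
  match n with
  | O => 0
  | S m => psum i m + / INR (S m) ^ i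
  end.

(** The list [e_j; ...; e_0] of elementary symmetric functions whose power sums
    are [p 1, p 2, ...], by Newton's identities. *)
Fixpoint esyms (p : nat -> R) (j : nat) : list R :=
  match j with
  | O => [1]
  | S j' =>
      let l := esyms p j' in
      sum_f_R0 (fun i => (-1) ^ i * p (S i) * nth i l 0) j' / INR (S j') :: l
  end.

Definition esym (p : nat -> R) (j : nat) : R := nth 0 (esyms p j) 0.

Lemma nth_esyms p j i : (i <= j)%nat -> nth i (esyms p j) 0 = esym p (j - i).
Proof.
  revert i; induction j as [|j IH]; intros [|i] Hi; try lia; try reflexivity.
  simpl; apply IH; lia.
Qed.

Lemma esym_newton p j :
  INR (S j) * esym p (S j) = sum_f_R0 (fun i => (-1) ^ i * p (S i) * esym p (j - i)) j.
Proof.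
  unfold esym at 1; cbn [esyms nth].
  rewrite (sum_eq _ (fun i => (-1) ^ i * p (S i) * esym p (j - i))).
  - field; apply not_0_INR; lia.
  - intros i Hi; now rewrite nth_esyms.
Qed.

(** As [P_1_succ] shows, these are the elementary symmetric functions of
    [1, 1/2, ..., 1/n]. *)
Definition elem (j n : nat) : R := P 1 j n / INR (fact j).

Lemma elem_succ j n : elem (S j) (S n) = elem (S j) n + / INR (S n) * elem j n.
Proof.
  unfold elem; rewrite P_1_succ; simpl pred.
  change (fact (S j)) with (S j * fact j)%nat; rewrite mult_INR; field.
  repeat split; try apply INR_fact_neq_0; apply not_0_INR; lia.
Qed.

Lemma elem_0 n : elem 0 n = 1.
Proof. unfold elem; rewrite P_1_0; simpl; field. Qed.

Lemma elem_newton j n :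
  INR (S j) * elem (S j) n
  = sum_f_R0 (fun i => (-1) ^ i * psum (S i) n * elem (j - i) n) j.
Proof.
  revert j; induction n as [|n IH]; intros j.
  { rewrite (sum_eq _ (fun _ => 0)) by (intros; cbn [psum]; ring).
    rewrite sum_cte; unfold elem; simpl; field.
    change (INR (fact j + j * fact j)) with (INR (fact (S j))); apply INR_fact_neq_0. }
  set (y := / INR (S n)).
  (* The contribution of the new variable y telescopes. *)
  assert (U : forall j, sum_f_R0 (fun i => (-1) ^ i * y ^ S i * elem (j - i) (S n)) j
                        = y * elem j n).
  { clear j; induction j as [|j IHj].
    - simpl; rewrite !elem_0; ring.
    - rewrite decomp_sum by lia; simpl pred.
      rewrite (sum_eq _ (fun i => (-1) ^ i * y ^ S i * elem (j - i) (S n) * - y)).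
      + rewrite <- scal_sum, IHj, Nat.sub_0_r, elem_succ; fold y; simpl; ring.
      + intros i Hi; simpl; ring. }
  rewrite (sum_eq _ (fun i => (-1) ^ i * psum (S i) n * elem (j - i) (S n)
                              + (-1) ^ i * y ^ S i * elem (j - i) (S n))).
  2: { intros i Hi; cbn [psum]; fold y; rewrite <- pow_inv; fold y; ring. }
  rewrite plus_sum, U, elem_succ; fold y.
  destruct j as [|j].
  { simpl sum_f_R0; rewrite !elem_0; pose proof (IH 0%nat) as E; simpl sum_f_R0 in E.
    rewrite elem_0 in E; simpl in *; lra. }
  rewrite tech5, Nat.sub_diag, elem_0.
  rewrite (sum_eq _ (fun i => (-1) ^ i * psum (S i) n * elem (S j - i) n
                     + (-1) ^ i * psum (S i) n * elem (j - i) n * y)).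
  2: { intros i Hi; replace (S j - i)%nat with (S (j - i)) by lia.
       rewrite elem_succ; fold y; ring. }
  rewrite plus_sum, <- scal_sum, <- IH.
  pose proof (IH (S j)) as E; rewrite tech5, Nat.sub_diag, elem_0 in E.
  rewrite (S_INR (S j)) in *; lra.
Qed.

Lemma elem_esym j n : elem j n = esym (fun i => psum i n) j.
Proof.
  induction j as [j IH] using (well_founded_induction lt_wf).
  destruct j as [|j]; [now rewrite elem_0|].
  apply (Rmult_eq_reg_l (INR (S j))); [|apply not_0_INR; lia].
  rewrite elem_newton, esym_newton; apply sum_eq; intros i Hi; rewrite IH by lia.
  reflexivity.
Qed.

Lemma approx_esym (p q : nat -> nat -> R) :
  (forall i, approx (p (S i)) (q (S i))) ->
  forall j, approx (fun n => esym (fun i => p i n) j) (fun n => esym (fun i => q i n) j).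
Proof.
  intros H j; induction j as [j IH] using (well_founded_induction lt_wf).
  destruct j as [|j]; [apply (approx_const 1)|].
  assert (HS : INR (S j) <> 0) by (apply not_0_INR; lia).
  assert (E : forall (r : nat -> nat -> R) n, / INR (S j) *
     sum_f_R0 (fun i => (-1) ^ i * r (S i) n * esym (fun i => r i n) (j - i)) j
     = esym (fun i => r i n) (S j)).
  { intros r n.
    rewrite <- (esym_newton (fun i => r i n)); field; easy. }
  eapply approx_ext; [intros n; apply (E p)|intros n; apply (E q)|].
  apply approx_scal.
  apply (approx_sum (fun i n => (-1) ^ i * p (S i) n * esym (fun k => p k n) (j - i))
                    (fun i n => (-1) ^ i * q (S i) n * esym (fun k => q k n) (j - i))).
  intros i Hi; apply approx_mult; [apply approx_scal, H|apply IH; lia].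
Qed.

(** * Power sums converge to zeta values *)

Lemma psum_sum i n : psum i (S n) = sum_n (fun k => / INR (S k) ^ i) n.
Proof.
  induction n as [|n IH]; [rewrite sum_O; simpl; ring|].
  rewrite sum_Sn, <- IH; reflexivity.
Qed.

Lemma psum_incr i n m : (n <= m)%nat -> psum i n <= psum i m.
Proof.
  induction 1 as [|m Hm IH]; [lra|].
  cbn [psum]; assert (0 < / INR (S m) ^ i); [|lra].
  apply Rinv_0_lt_compat, pow_lt, lt_0_INR; lia.
Qed.

(** Compared with the telescoping series of [2 / (k (k + 1))]. *)
Lemma psum_tail i n m :
  (2 <= i)%nat -> (n <= m)%nat -> psum i m <= psum i n + 2 / (INR n + 1) - 2 / (INR m + 1).
Proof.
  intros Hi; induction 1 as [|m Hm IH]; [lra|].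
  cbn [psum]; rewrite S_INR; pose proof (pos_INR m) as Hp.
  assert (/ (INR m + 1) ^ i <= 2 / (INR m + 1) - 2 / (INR m + 1 + 1)); [|lra].
  replace (2 / (INR m + 1) - 2 / (INR m + 1 + 1))
    with (/ ((INR m + 1) * ((INR m + 1 + 1) / 2))) by (field; lra).
  apply Rinv_le_contravar; [nra|].
  apply Rle_trans with ((INR m + 1) ^ 2); [nra|apply Rle_pow; [lra|easy]].
Qed.

Lemma is_lim_psum i : (2 <= i)%nat -> is_lim_seq (psum i) (zeta (INR i)).
Proof.
  intros Hi; apply is_lim_seq_incr_1.
  apply is_lim_seq_ext with (fun n => sum_n (fun k => Rpower (INR (S k)) (- INR i)) n).
  { intros n; rewrite psum_sum; apply sum_n_ext; intros k.
    rewrite Rpower_Ropp, Rpower_pow; [easy|apply lt_0_INR; lia]. }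
  apply Series_correct.
  apply ex_series_ext with (fun k => / INR (S k) ^ i).
  { intros k; rewrite Rpower_Ropp, Rpower_pow; [easy|apply lt_0_INR; lia]. }
  destruct (ex_finite_lim_seq_incr (fun n => psum i (S n)) 2) as [l Hl].
  - intros n; apply psum_incr; lia.
  - intros n; pose proof (psum_tail i 0 (S n) Hi ltac:(lia)) as T; simpl INR at 1 in T.
    assert (0 < 2 / (INR (S n) + 1)).
    { apply Rdiv_lt_0_compat; [lra|]; pose proof (pos_INR (S n)); lra. }
    change (psum i 0) with 0 in T; change (INR 0) with 0 in T; lra.
  - exists l; change (is_lim_seq (sum_n (fun k => / INR (S k) ^ i)) (Finite l)).
    apply (is_lim_seq_ext (fun n => psum i (S n))); [|exact Hl].
    intros n; apply psum_sum.
Qed.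

Lemma psum_le_zeta i n : (2 <= i)%nat -> psum i n <= zeta (INR i).
Proof.
  intros Hi; apply (is_lim_seq_le_loc (fun _ => psum i n) (psum i)
    (Finite (psum i n)) (Finite (zeta (INR i)))).
  - exists n; intros m Hm; now apply psum_incr.
  - apply is_lim_seq_const.
  - now apply is_lim_psum.
Qed.

Lemma zeta_le_psum i n : (2 <= i)%nat -> zeta (INR i) <= psum i n + 2 / (INR n + 1).
Proof.
  intros Hi; apply (is_lim_seq_le_loc (psum i) (fun _ => psum i n + 2 / (INR n + 1))
    (Finite (zeta (INR i))) (Finite (psum i n + 2 / (INR n + 1)))).
  - exists n; intros m Hm; pose proof (psum_tail i n m Hi Hm).
    assert (0 < 2 / (INR m + 1)); [|lra].
    apply Rdiv_lt_0_compat; [lra|]; pose proof (pos_INR m); lra.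
  - now apply is_lim_psum.
  - apply is_lim_seq_const.
Qed.

(** The power sums to leading order, with [h] in place of the harmonic number. *)
Definition psum_lim (h : R) (i : nat) : R :=
  if (i =? 1)%nat then h else zeta (INR i).

Lemma psum_1 n : psum 1 n = harm n.
Proof.
  induction n as [|n IH]; [reflexivity|].
  cbn [psum]; rewrite harm_succ, IH, S_INR, pow_1; reflexivity.
Qed.

Lemma approx_psum i : approx (psum (S i)) (fun n => psum_lim (harm n) (S i)).
Proof.
  destruct i as [|i].
  - apply approx_ext with harm harm; [intros; now rewrite psum_1|reflexivity|].
    apply approx_refl, tame_harm.
  - split; [|apply (tame_const (zeta (INR (S (S i)))))].
    apply negl_le with (fun n => 2 * / (INR n + 1)).
    + intros n; unfold psum_lim; cbn [Nat.eqb].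
      pose proof (psum_le_zeta (S (S i)) n ltac:(lia)).
      pose proof (zeta_le_psum (S (S i)) n ltac:(lia)).
      rewrite Rabs_minus_sym, Rabs_pos_eq; unfold Rdiv in *; lra.
    + apply negl_ext with (fun n => / (INR n + 1) * 2); [intros; ring|].
      apply negl_mult_tame; [apply negl_inv|apply tame_const].
Qed.

(** The leading order of [P 1 j], as a polynomial in the harmonic number. *)
Definition log_pow (h : R) (j : nat) : R := INR (fact j) * esym (psum_lim h) j.

Lemma approx_P_1 j : approx (P 1 j) (fun n => log_pow (harm n) j).
Proof.
  apply approx_ext with (fun n => INR (fact j) * elem j n)
                        (fun n => INR (fact j) * esym (psum_lim (harm n)) j).
  - intros n; unfold elem; field; apply INR_fact_neq_0.
  - reflexivity.
  - apply approx_scal.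
    eapply approx_ext; [intros n; symmetry; apply elem_esym|reflexivity|].
    apply (approx_esym psum (fun i n => psum_lim (harm n) i)), approx_psum.
Qed.

(** A negligible sequence converges, hence is bounded. *)
Lemma tame_approx u v : approx u v -> tame u.
Proof.
  intros [N T].
  assert (B : tame (fun n => u n - v n)).
  { specialize (N 0%nat); assert (ex_finite_lim_seq (fun n => u n - v n)) as X.
    { exists 0; eapply is_lim_seq_ext; [|exact N]; intros n; simpl; ring. }
    destruct (filterlim_bounded (fun n => u n - v n)) as [M HM].
    - destruct X as [l Hl]; now exists l.
    - exists 0%nat, M; intros n; simpl; rewrite Rmult_1_r; apply HM. }
  destruct (tame_plus _ _ B T) as (k & K & HK).
  exists k, K; intros n; specialize (HK n); simpl in HK.
  now replace (u n - v n + v n) with (u n) in HK by ring.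
Qed.

Lemma P_leading a j :
  approx (fun n => P (S a) j n / (INR n + 1) ^ a) (fun n => ev (lead a j) (log_pow (harm n))).
Proof.
  eapply approx_trans.
  - apply P_asymptotic; intros i; eapply tame_approx, approx_P_1.
  - apply (approx_ev _ (fun i n => P 1 i n) (fun i n => log_pow (harm n) i)), approx_P_1.
Qed.

(** * Leading order of the central moments *)

(** The coefficient of [n ^ r], along the sequences [P 1 i]. *)
Fixpoint leading (r : nat) (e : lincomb) : list Q :=
  match e with
  | [] => []
  | (a, j, c) :: e' =>
      if (a =? S r)%nat then ladd (lscal c (lead r j)) (leading r e') else leading r e'
  end.

Definition pole_order_le (r : nat) (e : lincomb) : bool :=
  forallb (fun '(a, j, c) => andb (1 <=? a) (a <=? S r))%nat e.

Lemma interp_leading r e :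
  pole_order_le r e = true ->
  approx (fun n => interp e n / (INR n + 1) ^ r)
         (fun n => ev (leading r e) (log_pow (harm n))).
Proof.
  induction e as [|[[a j] c] e IH]; intros He.
  { apply approx_ext with (fun _ => 0) (fun _ => 0);
      [intros n; rewrite interp_nil; unfold Rdiv; ring|reflexivity|apply approx_const]. }
  apply andb_prop in He as [Ha He]; apply andb_prop in Ha as [Ha1 Ha2].
  apply Nat.leb_le in Ha1, Ha2; specialize (IH He).
  destruct a as [|a]; [lia|]; cbn [leading].
  destruct (Nat.eqb_spec (S a) (S r)) as [Ea|Na].
  - injection Ea as ->.
    eapply approx_ext; [| |apply approx_plus;
      [apply (approx_scal (Q2R c)), (P_leading r j)|exact IH]].
    + intros n; rewrite interp_cons; unfold Rdiv; ring.
    + intros n; rewrite ev_ladd, ev_lscal; reflexivity.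
  - (* A lower pole order costs at least one factor 1 / (n + 1). *)
    assert (N1 : approx (fun n => / (INR n + 1)) (fun _ => 0)) by apply approx_negl, negl_inv.
    eapply approx_ext; [| |apply approx_plus;
      [apply (approx_scal (Q2R c)), approx_mult;
        [apply (P_leading a j)
        |apply approx_mult;
          [exact N1|apply (approx_pow _ _ (r - a - 1) N1)]]|exact IH]].
    + intros n; rewrite interp_cons; pose proof (pos_INR n).
      replace r with (a + (1 + (r - a - 1)))%nat at 2 3 by lia.
      rewrite !pow_add, pow_inv, pow_1; field.
      repeat split; try apply pow_nonzero; lra.
    + intros n; simpl; ring.
Qed.

Definition leading_moments : list (list Q) :=
  Eval vm_compute in map (fun r => leading r (moment_gf r)) (seq 0 9).

Definition leading_moment (r : nat) : list Q := nth r leading_moments [].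

Lemma leading_moment_eq r : (r <= 8)%nat -> leading_moment r = leading r (moment_gf r).
Proof.
  intros Hr; do 9 (destruct r as [|r]; [vm_compute; reflexivity|]); lia.
Qed.

Lemma pole_order_moment_gf r : (r <= 8)%nat -> pole_order_le r (moment_gf r) = true.
Proof.
  intros Hr.
  assert (A : forallb (fun r => pole_order_le r (moment_gf r)) (seq 0 9) = true)
    by (vm_cast_no_check (eq_refl true)).
  rewrite forallb_forall in A; apply A, in_seq; lia.
Qed.

Lemma moment_leading r :
  (r <= 8)%nat ->
  approx (fun n => expect (comparisons n) (fun k => dpow r (INR k)) / (INR n + 1) ^ r)
         (fun n => ev (leading_moment r) (log_pow (harm n))).
Proof.
  intros Hr; rewrite leading_moment_eq by easy.
  eapply approx_ext; [| |apply interp_leading, pole_order_moment_gf, Hr]; [|reflexivity].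
  intros n; simpl; now rewrite moments_interp.
Qed.

(** The leading order of the central moment, as a function of the harmonic number
    [h]; the mean is of order [n] times [ev (leading_moment 1) (log_pow h)]. *)
Definition central_limit (r : nat) (h : R) : R :=
  INR (fact r) * conv (fun i => ev (leading_moment i) (log_pow h))
                      (fun i => dpow i (- ev (leading_moment 1) (log_pow h))) r.

Lemma approx_central_moment r :
  (r <= 8)%nat ->
  approx (fun n => central_moment r n / (INR n + 1) ^ r) (fun n => central_limit r (harm n)).
Proof.
  intros Hr.
  apply approx_ext with
    (fun n => INR (fact r) *
       sum_f_R0 (fun i => (expect (comparisons n) (fun k => dpow i (INR k)) / (INR n + 1) ^ i)
         * (/ INR (fact (r - i)) * (- 1 *
           (expect (comparisons n) (fun k => dpow 1 (INR k)) / (INR n + 1) ^ 1)) ^ (r - i))) r)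
    (fun n => INR (fact r) *
       sum_f_R0 (fun i => ev (leading_moment i) (log_pow (harm n))
         * (/ INR (fact (r - i)) * (- 1 * ev (leading_moment 1) (log_pow (harm n))) ^ (r - i))) r).
  - intros n; rewrite central_moment_raw; unfold conv, Rdiv.
    rewrite (Rmult_assoc (INR (fact r))); f_equal.
    rewrite (Rmult_comm (sum_f_R0 _ _)), scal_sum.
    apply sum_eq; intros i Hi; unfold dpow; pose proof (pos_INR n).
    replace (/ (INR n + 1) ^ r) with (/ (INR n + 1) ^ i * / (INR n + 1) ^ (r - i)).
    2: { rewrite <- Rinv_mult, <- pow_add; do 2 f_equal; lia. }
    rewrite pow_1, <- (pow_inv (INR n + 1) (r - i)).
    rewrite (Rmult_comm (expect _ _) (/ (INR n + 1))).
    replace (-1 * (/ (INR n + 1) * expect (comparisons n) (fun k => INR k ^ 1 / INR (fact 1))))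
      with (/ (INR n + 1) * - expect (comparisons n) (fun k => INR k ^ 1 / INR (fact 1))) by ring.
    rewrite Rpow_mult_distr; unfold Rdiv; ring.
  - intros n; unfold central_limit, conv; f_equal; apply sum_eq; intros i Hi.
    unfold dpow, Rdiv; replace (- 1 * ev (leading_moment 1) (log_pow (harm n)))
      with (- ev (leading_moment 1) (log_pow (harm n))) by ring; ring.
  - apply approx_scal.
    apply (approx_sum
      (fun i n => (expect (comparisons n) (fun k => dpow i (INR k)) / (INR n + 1) ^ i)
         * (/ INR (fact (r - i)) * (- 1 *
           (expect (comparisons n) (fun k => dpow 1 (INR k)) / (INR n + 1) ^ 1)) ^ (r - i)))
      (fun i n => ev (leading_moment i) (log_pow (harm n))
         * (/ INR (fact (r - i)) * (- 1 * ev (leading_moment 1) (log_pow (harm n))) ^ (r - i)))).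
    intros i Hi; apply approx_mult; [apply moment_leading; lia|].
    apply approx_scal, approx_pow, approx_scal, moment_leading; lia.
Qed.

Lemma esym_0 p : esym p 0 = 1.
Proof. reflexivity. Qed.

Lemma esym_values h :
  let z i := zeta (INR i) in
  let e := esym (psum_lim h) in
  e 1%nat = h /\
  e 2%nat = (h * e 1%nat - z 2%nat) / 2 /\
  e 3%nat = (h * e 2%nat - z 2%nat * e 1%nat + z 3%nat) / 3 /\
  e 4%nat = (h * e 3%nat - z 2%nat * e 2%nat + z 3%nat * e 1%nat - z 4%nat) / 4 /\
  e 5%nat = (h * e 4%nat - z 2%nat * e 3%nat + z 3%nat * e 2%nat - z 4%nat * e 1%nat
             + z 5%nat) / 5 /\
  e 6%nat = (h * e 5%nat - z 2%nat * e 4%nat + z 3%nat * e 3%nat - z 4%nat * e 2%nat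
             + z 5%nat * e 1%nat - z 6%nat) / 6 /\
  e 7%nat = (h * e 6%nat - z 2%nat * e 5%nat + z 3%nat * e 4%nat - z 4%nat * e 3%nat
             + z 5%nat * e 2%nat - z 6%nat * e 1%nat + z 7%nat) / 7 /\
  e 8%nat = (h * e 7%nat - z 2%nat * e 6%nat + z 3%nat * e 5%nat - z 4%nat * e 4%nat
             + z 5%nat * e 3%nat - z 6%nat * e 2%nat + z 7%nat * e 1%nat - z 8%nat) / 8.
Proof.
  intros z e.
  assert (N : forall j, e (S j) = sum_f_R0 (fun i => (-1) ^ i * psum_lim h (S i) * e (j - i)%nat) j
                          / IZR (Z.of_nat (S j))).
  { intros j; rewrite <- (esym_newton (psum_lim h)), <- INR_IZR_INZ; fold e; field.
    apply not_0_INR; lia. }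
  repeat apply conj; rewrite N; cbn [sum_f_R0 Nat.sub pow];
    change (e 0%nat) with 1; unfold psum_lim; cbn [Nat.eqb Z.of_nat Pos.of_succ_nat Pos.succ];
    fold (z 2%nat) (z 3%nat) (z 4%nat) (z 5%nat) (z 6%nat) (z 7%nat) (z 8%nat);
    field.
Qed.

Lemma central_limit_2 h : central_limit 2 h = 7 - 4 * zeta (INR 2).
Proof.
  unfold central_limit, conv, dpow; cbn [sum_f_R0 Nat.sub].
  unfold leading_moment, leading_moments; cbn [nth ev]; unfold log_pow, Q2R; cbn [Qnum Qden].
  destruct (esym_values h) as (E1 & E2 & _); cbv zeta in E2.
  rewrite esym_0, E2, E1; simpl INR; field.
Qed.

(** The [k r] are the limiting cumulants, and the right-hand side is the general
    expression of an eighth central moment by cumulants.  All powers of [h] cancel,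
    as they must since [h] only accounts for the drift of the mean. *)
Lemma central_limit_8 h :
  let z i := zeta (INR i) in
  let k2 := 7 - 4 * z 2%nat in
  let k3 := -19 + 16 * z 3%nat in
  let k4 := 937 / 9 - 96 * z 4%nat in
  let k5 := - 85981 / 108 + 768 * z 5%nat in
  let k6 := 21096517 / 2700 - 7680 * z 6%nat in
  let k8 := 19281922400989 / 14883750 - 1290240 * z 8%nat in
  central_limit 8 h
  = k8 + 28 * k6 * k2 + 56 * k5 * k3 + 35 * k4 ^ 2 + 210 * k4 * k2 ^ 2
    + 280 * k3 ^ 2 * k2 + 105 * k2 ^ 4.
Proof.
  intros z k2 k3 k4 k5 k6 k8; unfold k2, k3, k4, k5, k6, k8, central_limit, conv, dpow;
    clear k2 k3 k4 k5 k6 k8; cbn [sum_f_R0 Nat.sub].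
  unfold leading_moment, leading_moments; cbn [nth ev]; unfold log_pow.
  pose proof (esym_values h) as E; cbv zeta in E; fold z in E.
  assert (F0 : INR (fact 0) = 1) by (rewrite INR_IZR_INZ; now vm_compute (Z.of_nat _)).
  assert (F1 : INR (fact 1) = 1) by (rewrite INR_IZR_INZ; now vm_compute (Z.of_nat _)).
  assert (F2 : INR (fact 2) = 2) by (rewrite INR_IZR_INZ; now vm_compute (Z.of_nat _)).
  assert (F3 : INR (fact 3) = 6) by (rewrite INR_IZR_INZ; now vm_compute (Z.of_nat _)).
  assert (F4 : INR (fact 4) = 24) by (rewrite INR_IZR_INZ; now vm_compute (Z.of_nat _)).
  assert (F5 : INR (fact 5) = 120) by (rewrite INR_IZR_INZ; now vm_compute (Z.of_nat _)).
  assert (F6 : INR (fact 6) = 720) by (rewrite INR_IZR_INZ; now vm_compute (Z.of_nat _)).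
  assert (F7 : INR (fact 7) = 5040) by (rewrite INR_IZR_INZ; now vm_compute (Z.of_nat _)).
  assert (F8 : INR (fact 8) = 40320) by (rewrite INR_IZR_INZ; now vm_compute (Z.of_nat _)).
  rewrite F8, F7, F6, F5, F4, F3, F2, F1, F0.
  unfold Q2R; cbn [Qnum Qden].
  rewrite esym_0.
destruct E as (E1 & E2 & E3 & E4 & E5 & E6 & E7 & E8).
  rewrite E8, E7, E6, E5, E4, E3, E2, E1.
  generalize (z 2%nat) (z 3%nat) (z 4%nat) (z 5%nat) (z 6%nat) (z 7%nat) (z 8%nat).
  clear; intros.
  field.
Qed.

(** * Even zeta values *)

(** The midpoints of the [2 ^ m] equal parts of the first quadrant. *)
Definition node (m k : nat) : R := (2 * INR k + 1) * PI / (4 * 2 ^ m).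

Lemma sum_map_seq_rev (f : nat -> R) n :
  sum_map f (seq 0 n) = sum_map (fun k => f (n - 1 - k)%nat) (seq 0 n).
Proof.
  rewrite <- (sum_map_map _ _ (fun k => n - 1 - k)%nat f).
  rewrite (sum_map_perm _ _ _ _ (Permutation_rev (seq 0 n))); f_equal.
  apply nth_ext with (d := 0%nat) (d' := (n - 1 - 0)%nat).
  - now rewrite length_rev, length_map.
  - intros i Hi; rewrite length_rev, length_seq in Hi.
    rewrite (map_nth (fun k => n - 1 - k)%nat), rev_nth, length_seq, !seq_nth
      by (rewrite ?length_seq; lia); lia.
Qed.

Lemma sum_map_seq_double (f : nat -> R) n :
  sum_map f (seq 0 (n + n))
  = sum_map (fun k => f k + f (n + (n - 1 - k))%nat) (seq 0 n).
Proof.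
  rewrite seq_app, sum_map_app, sum_map_plus; f_equal.
  transitivity (sum_map (fun k => f (n + k)%nat) (seq 0 n));
    [|apply sum_map_seq_rev].
  rewrite <- (sum_map_map _ _ (fun k => n + k)%nat f); f_equal.
  apply nth_ext with (d := 0%nat) (d' := (n + 0)%nat).
  - now rewrite length_map, !length_seq.
  - intros i Hi; rewrite length_seq in Hi.
    rewrite (map_nth (fun k => n + k)%nat), !seq_nth by lia; lia.
Qed.

Lemma pow2_pos m : 0 < 2 ^ m.
Proof. apply pow_lt; lra. Qed.

Lemma INR_pow2 m : INR (2 ^ m) = 2 ^ m.
Proof. rewrite pow_INR; reflexivity. Qed.

Lemma node_bounds m k : (k < 2 ^ m)%nat -> 0 < node m k < PI / 2.
Proof.
  intros Hk; apply lt_INR in Hk as Hk'; rewrite INR_pow2 in Hk'.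
  apply le_INR in Hk; rewrite S_INR, INR_pow2 in Hk.
  unfold node; pose proof (pow2_pos m); pose proof PI_RGT_0; pose proof (pos_INR k).
  split.
  - apply Rdiv_lt_0_compat; nra.
  - apply Rmult_lt_reg_r with (4 * 2 ^ m); [lra|].
    replace ((2 * INR k + 1) * PI / (4 * 2 ^ m) * (4 * 2 ^ m)) with ((2 * INR k + 1) * PI)
      by (field; lra).
    nra.
Qed.

Definition csc_sum (p m : nat) : R :=
  sum_map (fun k => (/ sin (node m k) ^ 2) ^ p) (seq 0 (2 ^ m)).

(** Refining the partition splits each node [x] into [x / 2] and its
    complementary angle. *)
Lemma csc_sum_succ p m :
  csc_sum p (S m)
  = sum_map (fun k => (/ sin (node m k / 2) ^ 2) ^ p + (/ cos (node m k / 2) ^ 2) ^ p)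
      (seq 0 (2 ^ m)).
Proof.
  unfold csc_sum; replace (2 ^ S m)%nat with (2 ^ m + 2 ^ m)%nat by (simpl; lia).
  rewrite sum_map_seq_double; apply sum_map_ext; intros k Hk; apply in_seq in Hk.
  pose proof (pow2_pos m).
  replace (node (S m) k) with (node m k / 2) by (unfold node; simpl; field; lra).
  replace (node (S m) (2 ^ m + (2 ^ m - 1 - k))) with (PI / 2 - node m k / 2).
  - now rewrite sin_shift.
  - unfold node; rewrite plus_INR, !minus_INR, INR_pow2 by lia; simpl; field; lra.
Qed.

(** [u = 1 / sin (x/2) ^ 2] and [v = 1 / cos (x/2) ^ 2] have [4 / sin x ^ 2] both as
    sum and as product, so their power sums are polynomials in [1 / sin x ^ 2]. *)
Lemma csc_half x :
  0 < x < PI / 2 ->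
  exists X u v, X = / sin x ^ 2 /\ u = / sin (x / 2) ^ 2 /\ v = / cos (x / 2) ^ 2 /\
    u + v = 4 * X /\ u * v = 4 * X.
Proof.
  intros Hx; eexists _, _, _; do 3 (split; [reflexivity|]).
  assert (Hs : 0 < sin (x / 2)) by (apply sin_gt_0; lra).
  assert (Hc : 0 < cos (x / 2)) by (apply cos_gt_0; lra).
  replace (sin x) with (2 * sin (x / 2) * cos (x / 2))
    by (rewrite <- sin_2a; f_equal; field).
  pose proof (sin2_cos2 (x / 2)) as E; unfold Rsqr in E.
  split; [|field; lra].
  transitivity ((sin (x / 2) * sin (x / 2) + cos (x / 2) * cos (x / 2))
                / (sin (x / 2) ^ 2 * cos (x / 2) ^ 2)); [field|rewrite E; field]; lra.
Qed.

Lemma csc_sum_0 p : csc_sum p 0 = 2 ^ p.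
Proof.
  unfold csc_sum, node, sum_map; simpl.
  replace ((2 * 0 + 1) * PI / (4 * 1)) with (PI / 4) by field.
  rewrite sin_PI4, Rplus_0_r; f_equal.
  assert (0 < sqrt 2) by (apply sqrt_lt_R0; lra).
  replace (1 / sqrt 2 * (1 / sqrt 2 * 1)) with (/ (sqrt 2 * sqrt 2)) by (field; lra).
  rewrite sqrt_sqrt by lra; field.
Qed.

(** By [csc_half] the sums for [m + 1] are linear combinations of those for [m]; the
    resulting recursions, started at the single node [PI / 4], are solved by
    polynomials in [2 ^ m]. *)
Lemma csc_sum_closed m :
  let M := 2 ^ m in
  csc_sum 0 m = M /\
  csc_sum 1 m = 2 * M ^ 2 /\
  csc_sum 2 m = 8 / 3 * M ^ 4 + 4 / 3 * M ^ 2 /\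
  csc_sum 3 m = 64 / 15 * M ^ 6 + 8 / 3 * M ^ 4 + 16 / 15 * M ^ 2 /\
  csc_sum 4 m = 2176 / 315 * M ^ 8 + 256 / 45 * M ^ 6 + 112 / 45 * M ^ 4 + 32 / 35 * M ^ 2.
Proof.
  induction m as [|m IH]; [rewrite !csc_sum_0; simpl; repeat apply conj; field|].
  cbv zeta in IH |- *; destruct IH as (IH0 & IH1 & IH2 & IH3 & IH4).
  assert (R : forall p (c0 c1 c2 c3 c4 : R),
    (forall X u v, u + v = 4 * X -> u * v = 4 * X ->
       u ^ p + v ^ p = c0 + c1 * X ^ 1 + c2 * X ^ 2 + c3 * X ^ 3 + c4 * X ^ 4) ->
    csc_sum p (S m) = c0 * csc_sum 0 m + c1 * csc_sum 1 m + c2 * csc_sum 2 m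
                      + c3 * csc_sum 3 m + c4 * csc_sum 4 m).
  { intros p c0 c1 c2 c3 c4 H; rewrite csc_sum_succ; unfold csc_sum.
    rewrite <- !sum_map_scal, <- !sum_map_plus; apply sum_map_ext.
    intros k Hk; apply in_seq in Hk.
    destruct (csc_half (node m k)) as (X & u & v & EX & Eu & Ev & E1 & E2).
    - apply node_bounds; lia.
    - rewrite <- EX, <- Eu, <- Ev, (H X u v E1 E2); simpl; ring. }
  repeat apply conj.
  - rewrite (R 0%nat 2 0 0 0 0), IH0, IH1, IH2, IH3, IH4; [simpl; ring|intros; simpl; ring].
  - rewrite (R 1%nat 0 4 0 0 0), IH0, IH1, IH2, IH3, IH4; [simpl; field|intros; simpl; lra].
  - rewrite (R 2%nat 0 (-8) 16 0 0), IH0, IH1, IH2, IH3, IH4; [simpl; field|].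
    intros X u v E1 E2.
    transitivity ((u + v) ^ 2 - 2 * (u * v)); [ring|rewrite E1, E2; ring].
  - rewrite (R 3%nat 0 0 (-48) 64 0), IH0, IH1, IH2, IH3, IH4; [simpl; field|].
    intros X u v E1 E2.
    transitivity ((u + v) ^ 3 - 3 * (u * v) * (u + v)); [ring|rewrite E1, E2; ring].
  - rewrite (R 4%nat 0 0 32 (-256) 256), IH0, IH1, IH2, IH3, IH4; [simpl; field|].
    intros X u v E1 E2.
    transitivity (((u + v) ^ 2 - 2 * (u * v)) ^ 2 - 2 * (u * v) ^ 2);
      [ring|rewrite E1, E2; ring].
Qed.

(** From [sin x <= x <= tan x]. *)
Lemma csc_bounds x : 0 < x < PI / 2 -> / sin x ^ 2 - 1 <= / x ^ 2 <= / sin x ^ 2.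
Proof.
  intros Hx.
  assert (Hs : 0 < sin x) by (apply sin_gt_0; lra).
  assert (Hc : 0 < cos x) by (apply cos_gt_0; lra).
  assert (Hsx : sin x < x) by (apply sin_lt_x; lra).
  assert (Ht : x * cos x <= sin x).
  { destruct (MVT_cor2 (fun t => sin t - t * cos t) (fun t => t * sin t) 0 x)
      as (c & Ec & Hc'); [lra| |].
    - intros t _; apply is_derive_Reals; auto_derive; [easy|ring].
    - rewrite sin_0 in Ec; assert (0 <= sin c) by (apply sin_ge_0; lra).
      assert (0 <= c * sin c * (x - 0)) by (repeat apply Rmult_le_pos; lra); lra. }
  split.
  - pose proof (sin2_cos2 x) as E; unfold Rsqr in E.
    replace (/ sin x ^ 2 - 1) with (cos x ^ 2 * / sin x ^ 2).
    2: { transitivity ((1 - sin x * sin x) / sin x ^ 2); [|field; lra].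
         rewrite <- E; field; lra. }
    apply Rmult_le_reg_r with (sin x ^ 2 * x ^ 2); [apply Rmult_lt_0_compat; nra|].
    replace (cos x ^ 2 * / sin x ^ 2 * (sin x ^ 2 * x ^ 2)) with ((x * cos x) ^ 2)
      by (field; lra).
    replace (/ x ^ 2 * (sin x ^ 2 * x ^ 2)) with (sin x ^ 2) by (field; lra).
    apply pow_incr; split; [apply Rmult_le_pos|]; lra.
  - apply Rinv_le_contravar; [nra|apply pow_incr; lra].
Qed.

(** [w ^ (p + 1) >= (X - 1) ^ (p + 1) >= X ^ (p + 1) - (p + 1) X ^ p]. *)
Lemma pow_diff_bound X w p :
  0 <= w -> X - 1 <= w <= X -> 0 <= X ^ S p - w ^ S p <= INR (S p) * X ^ p.
Proof.
  intros Hw HX; induction p as [|p IH]; [simpl; lra|].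
  rewrite (S_INR (S p)).
  replace (X ^ S (S p) - w ^ S (S p)) with (X * (X ^ S p - w ^ S p) + w ^ S p * (X - w))
    by (simpl; ring).
  assert (0 <= w ^ S p <= X ^ S p) by (split; [apply pow_le; lra|apply pow_incr; lra]).
  replace ((INR (S p) + 1) * X ^ S p) with (X * (INR (S p) * X ^ p) + X ^ S p * 1)
    by (simpl; ring).
  split; [|apply Rplus_le_compat; [apply Rmult_le_compat_l|apply Rmult_le_compat]]; nra.
Qed.

Definition odd_sum (p n : nat) : R :=
  sum_map (fun k => / (2 * INR k + 1) ^ (2 * p)) (seq 0 n).

Lemma odd_sum_psum p n :
  odd_sum p n = psum (2 * p) (n + n) - / 4 ^ p * psum (2 * p) n.
Proof.
  induction n as [|n IH]; [unfold odd_sum; simpl; ring|].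
  unfold odd_sum in *; rewrite seq_S, sum_map_app, IH, Nat.add_0_l; cbn [sum_map fold_right].
  replace (S n + S n)%nat with (S (S (n + n))) by lia; cbn [psum].
  replace (INR (S (S (n + n)))) with (2 * INR (S n)) by (rewrite !S_INR, plus_INR; ring).
  replace (INR (S (n + n))) with (2 * INR n + 1) by (rewrite !S_INR, plus_INR; ring).
  rewrite Rpow_mult_distr, (pow_mult 2 2 p); replace (2 ^ 2) with 4 by ring.
  rewrite Rinv_mult; ring.
Qed.

Lemma csc_sum_odd p m :
  0 <= csc_sum (S p) m - (4 * 2 ^ m / PI) ^ (2 * S p) * odd_sum (S p) (2 ^ m)
    <= INR (S p) * csc_sum p m.
Proof.
  unfold odd_sum, csc_sum; rewrite <- !sum_map_scal.
  assert (B : forall k, In k (seq 0 (2 ^ m)) ->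
    0 <= (/ sin (node m k) ^ 2) ^ S p
         - (4 * 2 ^ m / PI) ^ (2 * S p) * / (2 * INR k + 1) ^ (2 * S p)
    <= INR (S p) * (/ sin (node m k) ^ 2) ^ p).
  { intros k Hk; apply in_seq in Hk.
    assert (Hn : 0 < node m k < PI / 2) by (apply node_bounds; lia).
    replace ((4 * 2 ^ m / PI) ^ (2 * S p) * / (2 * INR k + 1) ^ (2 * S p))
      with ((/ node m k ^ 2) ^ S p).
    - apply pow_diff_bound; [|now apply csc_bounds].
      left; apply Rinv_0_lt_compat; nra.
    - rewrite <- !pow_inv, <- pow_mult, <- Rpow_mult_distr; f_equal.
      unfold node; pose proof PI_RGT_0; pose proof (pow2_pos m); pose proof (pos_INR k).
      field; lra. }
  induction (seq 0 (2 ^ m)) as [|k l IH]; simpl; [lra|].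
  assert (Hl := IH (fun i Hi => B i (or_intror Hi))).
  assert (Hk := B k (or_introl eq_refl)).
  simpl in *; lra.
Qed.

Lemma is_lim_quarter : is_lim_seq (fun m => / (2 ^ m) ^ 2) 0.
Proof.
  apply is_lim_seq_ext with (fun m => (/ 4) ^ m).
  - intros m; rewrite pow_inv, <- pow_mult, Nat.mul_comm, pow_mult.
    now replace (2 ^ 2) with 4 by ring.
  - apply is_lim_seq_geom; rewrite Rabs_pos_eq; lra.
Qed.

Lemma filterlim_pow2 (f : nat -> nat) :
  (forall m, (m <= f m)%nat) -> filterlim f eventually eventually.
Proof.
  intros Hf Q [N HN]; exists N; intros n Hn; apply HN; specialize (Hf n); lia.
Qed.

(** The leading coefficient [alpha] of the sum of [1 / sin ^ (2 p)] determines
    [zeta (2 p)]: each [1 / sin x ^ 2] may be replaced by [1 / x ^ 2], up to sums of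
    lower order. *)
Lemma zeta_even p (alpha : R) :
  is_lim_seq (fun m => csc_sum (S p) m / (2 ^ m) ^ (2 * S p)) alpha ->
  is_lim_seq (fun m => csc_sum p m / (2 ^ m) ^ (2 * S p)) 0 ->
  zeta (INR (2 * S p)) * (1 - / 4 ^ S p) = alpha * (PI / 4) ^ (2 * S p).
Proof.
  intros Ha H0; set (q := (2 * S p)%nat) in *.
  pose proof PI_RGT_0 as HPI.
  assert (L1 : is_lim_seq (fun m => odd_sum (S p) (2 ^ m))
                 (zeta (INR q) * (1 - / 4 ^ S p))).
  { apply is_lim_seq_ext with
      (fun m => psum q (2 ^ m + 2 ^ m) + - / 4 ^ S p * psum q (2 ^ m)).
    - intros m; rewrite odd_sum_psum; fold q; ring.
    - replace (zeta (INR q) * (1 - / 4 ^ S p))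
        with (zeta (INR q) + - / 4 ^ S p * zeta (INR q)) by ring.
      apply is_lim_seq_plus'.
      + apply (is_lim_seq_subseq (psum q) _ (fun m => 2 ^ m + 2 ^ m)%nat).
        * apply filterlim_pow2; intros m; pose proof (Nat.pow_gt_lin_r 2 m); lia.
        * apply is_lim_psum; unfold q; lia.
      + apply is_lim_seq_mult'; [apply is_lim_seq_const|].
        apply (is_lim_seq_subseq (psum q) _ (fun m => 2 ^ m)%nat).
        * apply filterlim_pow2; intros m; pose proof (Nat.pow_gt_lin_r 2 m); lia.
        * apply is_lim_psum; unfold q; lia. }
  assert (L2 : is_lim_seq (fun m => odd_sum (S p) (2 ^ m)) (alpha * (PI / 4) ^ q)).
  { assert (D : forall m, odd_sum (S p) (2 ^ m) * (4 / PI) ^ q * (2 ^ m) ^ q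
                = (4 * 2 ^ m / PI) ^ q * odd_sum (S p) (2 ^ m)).
    { intros m; replace (4 * 2 ^ m / PI) with (4 / PI * 2 ^ m) by (field; lra).
      rewrite Rpow_mult_distr; ring. }
    apply is_lim_seq_ext with (fun m =>
      (odd_sum (S p) (2 ^ m) * (4 / PI) ^ q) * (PI / 4) ^ q).
    { intros m; rewrite Rmult_assoc, <- Rpow_mult_distr.
      replace (4 / PI * (PI / 4)) with 1 by (field; lra); rewrite pow1; ring. }
    apply is_lim_seq_mult'; [|apply is_lim_seq_const].
    apply is_lim_seq_le_le with
      (u := fun m => csc_sum (S p) m / (2 ^ m) ^ q
                     + - INR (S p) * (csc_sum p m / (2 ^ m) ^ q))
      (w := fun m => csc_sum (S p) m / (2 ^ m) ^ q).
    - intros m; pose proof (csc_sum_odd p m) as B; fold q in B; rewrite <- D in B.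
      assert (HM : 0 < (2 ^ m) ^ q) by apply pow_lt, pow2_pos.
      split; apply Rmult_le_reg_r with ((2 ^ m) ^ q); try easy; field_simplify; lra.
    - replace alpha with (alpha + - INR (S p) * 0) by ring.
      apply is_lim_seq_plus'; [exact Ha|].
      apply is_lim_seq_mult'; [apply is_lim_seq_const|exact H0].
    - exact Ha. }
  apply is_lim_seq_unique in L1, L2; rewrite L1 in L2; now injection L2.
Qed.

Lemma is_lim_poly_quarter c0 c1 c2 c3 c4 :
  is_lim_seq (fun m => let t := / (2 ^ m) ^ 2 in
                c0 + c1 * t + c2 * t ^ 2 + c3 * t ^ 3 + c4 * t ^ 4) c0.
Proof.
  assert (T : forall c k, is_lim_seq (fun m => c * (/ (2 ^ m) ^ 2) ^ S k) 0).
  { intros c k; replace (Finite 0) with (Finite (c * 0)) by (f_equal; ring).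
    apply is_lim_seq_mult'; [apply is_lim_seq_const|].
    induction k as [|k IH].
    - apply is_lim_seq_ext with (fun m => / (2 ^ m) ^ 2);
        [intros; simpl; ring|apply is_lim_quarter].
    - replace (Finite 0) with (Finite (0 * 0)) by (f_equal; ring).
      apply is_lim_seq_mult'; [apply is_lim_quarter|exact IH]. }
  replace (Finite c0) with (Finite (c0 + 0 + 0 + 0 + 0)) by (f_equal; ring).
  repeat apply is_lim_seq_plus'; try apply T; [apply is_lim_seq_const|].
  apply is_lim_seq_ext with (fun m => c1 * (/ (2 ^ m) ^ 2) ^ 1);
    [intros; simpl; ring|apply T].
Qed.

Lemma zeta_even_values :
  zeta (INR 2) = PI ^ 2 / 6 /\ zeta (INR 4) = PI ^ 4 / 90 /\
  zeta (INR 6) = PI ^ 6 / 945 /\ zeta (INR 8) = PI ^ 8 / 9450.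
Proof.
  assert (L : forall (u : nat -> R) (c0 c1 c2 c3 c4 : R),
    (forall m, u m = let t := / (2 ^ m) ^ 2 in
                     c0 + c1 * t + c2 * t ^ 2 + c3 * t ^ 3 + c4 * t ^ 4) ->
    is_lim_seq u c0).
  { intros u c0 c1 c2 c3 c4 H; eapply is_lim_seq_ext; [|apply is_lim_poly_quarter].
    intros m; symmetry; apply H. }
  assert (C := csc_sum_closed).
  pose proof (zeta_even 0 2) as E1; pose proof (zeta_even 1 (8 / 3)) as E2.
  pose proof (zeta_even 2 (64 / 15)) as E3; pose proof (zeta_even 3 (2176 / 315)) as E4.
  cbn [Nat.mul Nat.add] in E1, E2, E3, E4.
  repeat apply conj.
  - cut (zeta (INR 2) * (1 - / 4 ^ 1) = 2 * (PI / 4) ^ 2); [lra|apply E1].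
    + apply (L _ 2 0 0 0 0); intros m; cbv zeta;
        destruct (C m) as (S0 & S1 & S2 & S3 & S4).
      rewrite S1; pose proof (pow2_pos m); field; lra.
    + apply is_lim_seq_ext with (fun m => (/ 2) ^ m).
      * intros m; destruct (C m) as (S0 & S1 & S2 & S3 & S4); pose proof (pow2_pos m).
        rewrite S0, pow_inv; field; lra.
      * apply is_lim_seq_geom; rewrite Rabs_pos_eq; lra.
  - cut (zeta (INR 4) * (1 - / 4 ^ 2) = 8 / 3 * (PI / 4) ^ 4); [lra|apply E2].
    + apply (L _ (8 / 3) (4 / 3) 0 0 0); intros m; cbv zeta;
        destruct (C m) as (S0 & S1 & S2 & S3 & S4).
      rewrite S2; pose proof (pow2_pos m); field; lra.
    + apply (L _ 0 2 0 0 0); intros m; cbv zeta;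
        destruct (C m) as (S0 & S1 & S2 & S3 & S4).
      rewrite S1; pose proof (pow2_pos m); field; lra.
  - cut (zeta (INR 6) * (1 - / 4 ^ 3) = 64 / 15 * (PI / 4) ^ 6); [lra|apply E3].
    + apply (L _ (64 / 15) (8 / 3) (16 / 15) 0 0); intros m; cbv zeta;
        destruct (C m) as (S0 & S1 & S2 & S3 & S4).
      rewrite S3; pose proof (pow2_pos m); field; lra.
    + apply (L _ 0 (8 / 3) (4 / 3) 0 0); intros m; cbv zeta;
        destruct (C m) as (S0 & S1 & S2 & S3 & S4).
      rewrite S2; pose proof (pow2_pos m); field; lra.
  - cut (zeta (INR 8) * (1 - / 4 ^ 4) = 2176 / 315 * (PI / 4) ^ 8); [lra|apply E4].
    + apply (L _ (2176 / 315) (256 / 45) (112 / 45) (32 / 35) 0); intros m; cbv zeta;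
        destruct (C m) as (S0 & S1 & S2 & S3 & S4).
      rewrite S4; pose proof (pow2_pos m); field; lra.
    + apply (L _ 0 (64 / 15) (8 / 3) (16 / 15) 0); intros m; cbv zeta;
        destruct (C m) as (S0 & S1 & S2 & S3 & S4).
      rewrite S3; pose proof (pow2_pos m); field; lra.
Qed.

(** * Numerical bounds *)

(** If [f x - f (x + 1)] underestimates each term of the series, [f N] underestimates
    the tail, up to the value of [f] at infinity, which is at most 0. *)
Lemma zeta_ge_tail i N (f : R -> R) :
  (2 <= i)%nat ->
  (forall x, 1 <= x -> f x - f (x + 1) <= / (x + 1) ^ i) ->
  (forall x, 1 <= x -> f x <= 4 / (x + 1)) ->
  (1 <= N)%nat ->
  psum i N + f (INR N) <= zeta (INR i).
Proof.
  intros Hi Hf H0 HN.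
  assert (M : forall n, (N <= n)%nat -> psum i N + f (INR N) - 4 / (INR n + 1) <= psum i n).
  { intros n Hn.
    assert (psum i N + f (INR N) - f (INR n) <= psum i n).
    { induction Hn as [|n Hn IH]; [lra|].
      cbn [psum]; rewrite S_INR; apply le_INR in HN, Hn; simpl in HN.
      specialize (Hf (INR n) ltac:(lra)); lra. }
    apply le_INR in HN, Hn; simpl in HN; specialize (H0 (INR n) ltac:(lra)); lra. }
  apply (is_lim_seq_le_loc (fun n => psum i N + f (INR N) - 4 * / (INR n + 1)) (psum i)
    (Finite (psum i N + f (INR N))) (Finite (zeta (INR i)))).
  - exists N; exact M.
  - replace (psum i N + f (INR N)) with (psum i N + f (INR N) - 4 * 0) at 1 by ring.
    apply is_lim_seq_minus'; [apply is_lim_seq_const|].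
    apply is_lim_seq_mult'; [apply is_lim_seq_const|].
    apply approx_lim, approx_negl, negl_inv.
  - now apply is_lim_psum.
Qed.

Lemma zeta_le_tail i N (f : R -> R) :
  (2 <= i)%nat ->
  (forall x, 1 <= x -> / (x + 1) ^ i <= f x - f (x + 1)) ->
  (forall x, 1 <= x -> 0 <= f x) ->
  (1 <= N)%nat ->
  zeta (INR i) <= psum i N + f (INR N).
Proof.
  intros Hi Hf H0 HN.
  apply (is_lim_seq_le_loc (psum i) (fun _ => psum i N + f (INR N))
    (Finite (zeta (INR i))) (Finite (psum i N + f (INR N)))).
  - exists N; intros n Hn.
    assert (psum i n <= psum i N + f (INR N) - f (INR n)).
    { induction Hn as [|n Hn IH]; [lra|].
      cbn [psum]; rewrite S_INR; apply le_INR in HN, Hn; simpl in HN.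
      specialize (Hf (INR n) ltac:(lra)); lra. }
    apply le_INR in HN, Hn; simpl in HN; specialize (H0 (INR n) ltac:(lra)); lra.
  - now apply is_lim_psum.
  - apply is_lim_seq_const.
Qed.

(** Partial sums in units of [10 ^ -20], each term rounded down. *)
Fixpoint psumZ (i n : nat) : Z :=
  match n with
  | O => 0
  | S m => psumZ i m + 10 ^ 20 / Z.of_nat (S m) ^ Z.of_nat i
  end%Z.

Lemma psumZ_bounds i n :
  IZR (psumZ i n) <= 10 ^ 20 * psum i n <= IZR (psumZ i n) + INR n.
Proof.
  induction n as [|n IH]; [simpl; lra|].
  cbn [psum psumZ]; rewrite plus_IZR, S_INR.
  assert (Hk : 0 < INR (S n) ^ i) by (apply pow_lt, lt_0_INR; lia).
  assert (Ek : IZR (Z.of_nat (S n) ^ Z.of_nat i) = INR (S n) ^ i)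
    by (now rewrite <- pow_IZR, <- INR_IZR_INZ).
  assert (Hz : (0 < Z.of_nat (S n) ^ Z.of_nat i)%Z) by (apply Z.pow_pos_nonneg; lia).
  set (d := (Z.of_nat (S n) ^ Z.of_nat i)%Z) in *.
  pose proof (Z.mul_div_le (10 ^ 20) d Hz) as Hlo.
  pose proof (Z.mul_succ_div_gt (10 ^ 20) d Hz) as Hhi.
  apply IZR_le in Hlo; apply IZR_lt in Hhi.
  rewrite mult_IZR, Ek in Hlo, Hhi; rewrite succ_IZR in Hhi.
  replace (IZR (10 ^ 20)) with (10 ^ 20) in * by (rewrite pow_IZR; reflexivity).
  set (q := IZR (10 ^ 20 / d)) in *.
  rewrite S_INR in *.
  assert (q <= 10 ^ 20 * / (INR n + 1) ^ i <= q + 1); [|lra].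
  split; apply Rmult_le_reg_l with ((INR n + 1) ^ i); try easy;
    [|apply Rlt_le]; field_simplify; try lra.
Qed.

(** The error terms are those of the midpoint form of Euler-Maclaurin summation,
    whose partial sums alternately under- and overestimate the tail. *)
Definition tail2 (s : nat) (x : R) : R :=
  / (INR (s - 1) * (x + /2) ^ (s - 1)) - INR s / (24 * (x + /2) ^ (s + 1)).

Definition tail3 (s : nat) (x : R) : R :=
  tail2 s x + 7 * INR (s * (s + 1) * (s + 2)) / (5760 * (x + /2) ^ (s + 3)).

Lemma poly_nonneg (v : R) (c0 c1 c2 c3 c4 c5 : R) :
  0 <= v -> 0 <= c0 -> 0 <= c1 -> 0 <= c2 -> 0 <= c3 -> 0 <= c4 -> 0 <= c5 ->
  0 <= c0 + c1 * v + c2 * v ^ 2 + c3 * v ^ 3 + c4 * v ^ 4 + c5 * v ^ 5.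
Proof.
  intros; repeat apply Rplus_le_le_0_compat; try apply Rmult_le_pos; try apply pow_le; lra.
Qed.

Lemma quot_nonneg a b c : c = a / b -> 0 <= a -> 0 < b -> 0 <= c.
Proof. intros -> Ha Hb; apply Rmult_le_pos; [easy|left; now apply Rinv_0_lt_compat]. Qed.

(** Put over a common denominator, both telescoping estimates have a numerator that
    is a polynomial with positive coefficients in [v = 4 (x + 1) ^ 2 - 4]; the symmetry
    of [x + 1/2] and [x + 3/2] about [x + 1] leaves even powers of [x + 1] only. *)
Lemma tail2_step s x :
  In s [2; 3; 5]%nat -> 1 <= x -> tail2 s x - tail2 s (x + 1) <= / (x + 1) ^ s.
Proof.
  intros Hs Hx; apply Rminus_le_0; set (v := (2 * (x + 1)) ^ 2 - 4).
  assert (Hv : 0 <= v) by (unfold v; nra).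
  assert (D : forall a b, 0 < (v + 3) ^ a * (x + 1) ^ b)
    by (intros; apply Rmult_lt_0_compat; apply pow_lt; lra).
  destruct Hs as [<-|[<-|[<-|[]]]]; unfold tail2; cbn [Nat.sub Nat.add].
  - apply (quot_nonneg (100 / 3 + 28 / 3 * v + 0 * v ^ 2 + 0 * v ^ 3 + 0 * v ^ 4 + 0 * v ^ 5)
      (4 * ((v + 3) ^ 3 * (x + 1) ^ 2)));
      [|apply poly_nonneg; lra|apply Rmult_lt_0_compat; [lra|apply D]].
    unfold v; simpl INR; field; repeat split; nra.
  - apply (quot_nonneg (776 + 416 * v + 56 * v ^ 2 + 0 * v ^ 3 + 0 * v ^ 4 + 0 * v ^ 5)
      (8 * ((v + 3) ^ 4 * (x + 1) ^ 3)));
      [|apply poly_nonneg; lra|apply Rmult_lt_0_compat; [lra|apply D]].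
    unfold v; simpl INR; field; repeat split; nra.
  - apply (quot_nonneg (725344 / 3 + 740032 / 3 * v + 94688 * v ^ 2 + 48640 / 3 * v ^ 3
        + 3136 / 3 * v ^ 4 + 0 * v ^ 5) (32 * ((v + 3) ^ 6 * (x + 1) ^ 5)));
      [|apply poly_nonneg; lra|apply Rmult_lt_0_compat; [lra|apply D]].
    unfold v; simpl INR; field; repeat split; nra.
Qed.

Lemma tail3_step s x :
  In s [2; 3; 5]%nat -> 1 <= x -> / (x + 1) ^ s <= tail3 s x - tail3 s (x + 1).
Proof.
  intros Hs Hx; apply Rminus_le_0; set (v := (2 * (x + 1)) ^ 2 - 4).
  assert (Hv : 0 <= v) by (unfold v; nra).
  assert (D : forall a b, 0 < (v + 3) ^ a * (x + 1) ^ b)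
    by (intros; apply Rmult_lt_0_compat; apply pow_lt; lra).
  destruct Hs as [<-|[<-|[<-|[]]]]; unfold tail3, tail2; cbn [Nat.sub Nat.add Nat.mul].
  - apply (quot_nonneg (9052 / 15 + 1576 / 5 * v + 124 / 3 * v ^ 2 + 0 * v ^ 3 + 0 * v ^ 4
        + 0 * v ^ 5) (4 * ((v + 3) ^ 5 * (x + 1) ^ 2)));
      [|apply poly_nonneg; lra|apply Rmult_lt_0_compat; [lra|apply D]].
    unfold v; rewrite !INR_IZR_INZ; cbn [Z.of_nat Pos.of_succ_nat Pos.succ];
      field; repeat split; nra.
  - apply (quot_nonneg (60584 / 3 + 15344 * v + 3896 * v ^ 2 + 992 / 3 * v ^ 3 + 0 * v ^ 4
        + 0 * v ^ 5) (8 * ((v + 3) ^ 6 * (x + 1) ^ 3)));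
      [|apply poly_nonneg; lra|apply Rmult_lt_0_compat; [lra|apply D]].
    unfold v; rewrite !INR_IZR_INZ; cbn [Z.of_nat Pos.of_succ_nat Pos.succ];
      field; repeat split; nra.
  - apply (quot_nonneg (34616224 / 3 + 14041344 * v + 6838144 * v ^ 2 + 4998592 / 3 * v ^ 3
        + 203168 * v ^ 4 + 9920 * v ^ 5) (32 * ((v + 3) ^ 8 * (x + 1) ^ 5)));
      [|apply poly_nonneg; lra|apply Rmult_lt_0_compat; [lra|apply D]].
    unfold v; rewrite !INR_IZR_INZ; cbn [Z.of_nat Pos.of_succ_nat Pos.succ];
      field; repeat split; nra.
Qed.

Lemma tail2_le s x : In s [2; 3; 5]%nat -> 1 <= x -> tail2 s x <= 4 / (x + 1).
Proof.
  intros Hs Hx.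
  assert (E : tail2 s x <= / (x + /2)).
  { unfold tail2.
    assert (0 <= INR s / (24 * (x + / 2) ^ (s + 1))).
    { apply Rmult_le_pos; [apply pos_INR|left; apply Rinv_0_lt_compat].
      apply Rmult_lt_0_compat; [lra|apply pow_lt; lra]. }
    assert (/ (INR (s - 1) * (x + / 2) ^ (s - 1)) <= / (x + / 2)); [|lra].
    apply Rinv_le_contravar; [lra|].
    assert (1 <= INR (s - 1)) by (apply (le_INR 1); destruct Hs as [<-|[<-|[<-|[]]]]; simpl; lia).
    assert (x + / 2 <= (x + / 2) ^ (s - 1)); [|nra].
    rewrite <- (pow_1 (x + / 2)) at 1; apply Rle_pow; [lra|].
    destruct Hs as [<-|[<-|[<-|[]]]]; simpl; lia. }
  eapply Rle_trans; [exact E|].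
  replace (4 / (x + 1)) with (/ ((x + 1) / 4)) by (field; lra).
  apply Rinv_le_contravar; lra.
Qed.

Lemma tail3_pos s x : In s [2; 3; 5]%nat -> 1 <= x -> 0 <= tail3 s x.
Proof.
  intros Hs Hx; unfold tail3, tail2.
  assert (0 <= 7 * INR (s * (s + 1) * (s + 2)) / (5760 * (x + / 2) ^ (s + 3))).
  { apply Rmult_le_pos; [apply Rmult_le_pos; [lra|apply pos_INR]|left; apply Rinv_0_lt_compat].
    apply Rmult_lt_0_compat; [lra|apply pow_lt; lra]. }
  assert (0 <= / (INR (s - 1) * (x + / 2) ^ (s - 1)) - INR s / (24 * (x + / 2) ^ (s + 1)));
    [|lra].
  assert (Hp : 0 < (x + / 2) ^ (s - 1)) by (apply pow_lt; lra).
  replace (s + 1)%nat with (2 + (s - 1))%nat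
    by (destruct Hs as [<-|[<-|[<-|[]]]]; reflexivity).
  rewrite pow_add.
  apply (quot_nonneg (24 * (x + / 2) ^ 2 - INR (s - 1) * INR s)
    (24 * INR (s - 1) * (x + / 2) ^ 2 * (x + / 2) ^ (s - 1)));
    destruct Hs as [<-|[<-|[<-|[]]]]; simpl Nat.sub in *; simpl INR; try nra;
    try (field; lra);
    repeat apply Rmult_lt_0_compat; try apply pow_lt; lra.
Qed.

Lemma zeta_bounds s :
  In s [2; 3; 5]%nat ->
  IZR (psumZ s 200) / 10 ^ 20 + tail2 s 200 <= zeta (INR s)
  <= (IZR (psumZ s 200) + 200) / 10 ^ 20 + tail3 s 200.
Proof.
  intros Hs; assert (H2 : (2 <= s)%nat) by (destruct Hs as [<-|[<-|[<-|[]]]]; lia).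
  pose proof (zeta_ge_tail s 200 (tail2 s) H2 (fun x => tail2_step s x Hs)
    (fun x => tail2_le s x Hs) ltac:(lia)) as L.
  pose proof (zeta_le_tail s 200 (tail3 s) H2 (fun x => tail3_step s x Hs)
    (fun x => tail3_pos s x Hs) ltac:(lia)) as U.
  pose proof (psumZ_bounds s 200) as B.
  replace (INR 200) with 200 in * by (rewrite INR_IZR_INZ; reflexivity).
  split; [eapply Rle_trans; [|exact L]|eapply Rle_trans; [exact U|]];
    apply Rplus_le_compat_r; apply Rmult_le_reg_r with (10 ^ 20); try lra;
    field_simplify; lra.
Qed.

Lemma zeta_235_bounds :
  1.6449340668481 <= zeta (INR 2) <= 1.6449340668484 /\
  1.2020569031594 <= zeta (INR 3) <= 1.2020569031597 /\
  1.0369277551432 <= zeta (INR 5) <= 1.0369277551435.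
Proof.
  assert (E2 : psumZ 2 200 = 163994654601499726701%Z) by (vm_compute; reflexivity).
  assert (E3 : psumZ 3 200 = 120204446550334558654%Z) by (vm_compute; reflexivity).
  assert (E5 : psumZ 5 200 = 103692775498867591507%Z) by (vm_compute; reflexivity).
  pose proof (fun s => zeta_bounds s) as B; unfold tail3, tail2 in B.
  pose proof (B 2%nat ltac:(simpl; tauto)) as B2; pose proof (B 3%nat ltac:(simpl; tauto)) as B3.
  pose proof (B 5%nat ltac:(simpl; tauto)) as B5; clear B.
  rewrite E2 in B2; rewrite E3 in B3; rewrite E5 in B5.
  cbn [Nat.sub Nat.add Nat.mul] in B2, B3, B5.
  generalize dependent (zeta (INR 2)); generalize dependent (zeta (INR 3)).
  generalize dependent (zeta (INR 5)); intros z5 B5 z3 B3 z2 B2.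
  rewrite !INR_IZR_INZ in B2, B3, B5.
  cbn [Z.of_nat Pos.of_succ_nat Pos.succ] in B2, B3, B5.
  lra.
Qed.

(** * The limit *)

Lemma is_lim_central_moment r c :
  (r <= 8)%nat -> (forall h, central_limit r h = c) ->
  is_lim_seq (fun n => central_moment r n / (INR n + 1) ^ r) c.
Proof.
  intros Hr Hc; apply approx_lim.
  eapply approx_ext; [reflexivity| |apply approx_central_moment, Hr].
  intros n; apply Hc.
Qed.

Lemma mult_bounds a b x c d y :
  a <= x <= b -> c <= y <= d -> 0 <= a -> 0 <= c -> a * c <= x * y <= b * d.
Proof. intros Hx Hy Ha Hc; split; apply Rmult_le_compat; lra. Qed.

Theorem theorem8 :
  let v : R :=
    1 / 14883750 * / (7 - 2 / 3 * PI ^ 2) ^ 4 *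
    (90558126238639 - 7640378199300 * PI ^ 2 + 69766200000 * PI ^ 4
     - 5556600000 * PI ^ 6 - 354564000 * PI ^ 8
     - 28353601080000 * zeta 3 + 1689206400000 * zeta 3 * PI ^ 2
     + 7468070400000 * zeta 3 ^ 2 - 711244800000 * zeta 3 ^ 2 * PI ^ 2
     - 12162286080000 * zeta 5 + 10241925120000 * zeta 5 * zeta 3) in
  is_lim_seq (fun n : nat => central_moment 8 n / central_moment 2 n ^ 4)
             (Finite v)
  /\ 858.203 <= v < 858.204.
Proof.
  intros v.
  destruct zeta_even_values as (Z2 & Z4 & Z6 & Z8).
  destruct zeta_235_bounds as (B2 & B3 & B5).
  set (z2 := zeta (INR 2)) in *.
  assert (EP : PI ^ 2 = 6 * z2) by lra.
  replace (PI ^ 4) with (36 * z2 ^ 2) in Z4 by (rewrite Z2; field).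
  replace (PI ^ 6) with (216 * z2 ^ 3) in Z6 by (rewrite Z2; field).
  replace (PI ^ 8) with (1296 * z2 ^ 4) in Z8 by (rewrite Z2; field).
  set (z3 := zeta (INR 3)) in *; set (z5 := zeta (INR 5)) in *.
  set (num := 90558126238639 - 7640378199300 * (6 * z2) + 69766200000 * (36 * z2 ^ 2)
     - 5556600000 * (216 * z2 ^ 3) - 354564000 * (1296 * z2 ^ 4)
     - 28353601080000 * z3 + 1689206400000 * (z3 * (6 * z2))
     + 7468070400000 * (z3 * z3) - 711244800000 * (z3 * z3 * (6 * z2))
     - 12162286080000 * z5 + 10241925120000 * (z5 * z3)).
  assert (Ev : v = num / (14883750 * (7 - 4 * z2) ^ 4)).
  { unfold v, num.
    replace (zeta 3) with z3 by (unfold z3; f_equal; simpl; ring).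
    replace (zeta 5) with z5 by (unfold z5; f_equal; simpl; ring).
    replace (PI ^ 4) with ((PI ^ 2) ^ 2) by ring.
    replace (PI ^ 6) with ((PI ^ 2) ^ 3) by ring.
    replace (PI ^ 8) with ((PI ^ 2) ^ 4) by ring.
    rewrite EP; field; lra. }
  split.
  - rewrite Ev.
    apply is_lim_seq_ext with (fun n => (central_moment 8 n / (INR n + 1) ^ 8)
                                        / (central_moment 2 n / (INR n + 1) ^ 2) ^ 4).
    { intros n; pose proof (pos_INR n).
      unfold Rdiv; rewrite Rpow_mult_distr, Rinv_mult, <- !pow_inv, Rinv_inv.
      rewrite <- pow_mult; change (2 * 4)%nat with 8%nat.
      replace (central_moment 8 n * (/ (INR n + 1)) ^ 8
               * ((/ central_moment 2 n) ^ 4 * (INR n + 1) ^ 8))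
        with (central_moment 8 n * (/ central_moment 2 n) ^ 4
              * ((/ (INR n + 1)) ^ 8 * (INR n + 1) ^ 8)) by ring.
      rewrite <- Rpow_mult_distr, Rinv_l, pow1 by lra; ring. }
    replace (num / (14883750 * (7 - 4 * z2) ^ 4))
      with (num / 14883750 / (7 - 4 * z2) ^ 4) by (field; lra).
    apply is_lim_seq_div'.
    + apply is_lim_central_moment; [lia|]; intros h; rewrite central_limit_8; cbv zeta.
      fold z2 z3 z5; rewrite Z4, Z6, Z8; unfold num; field.
    + assert (L : is_lim_seq (fun n => central_moment 2 n / (INR n + 1) ^ 2) (7 - 4 * z2))
        by (apply is_lim_central_moment; [lia|apply central_limit_2]).
      pose proof (is_lim_seq_mult' _ _ _ _ L L) as L2.
      pose proof (is_lim_seq_mult' _ _ _ _ L2 L2) as L4.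
      replace ((7 - 4 * z2) ^ 4)
        with ((7 - 4 * z2) * (7 - 4 * z2) * ((7 - 4 * z2) * (7 - 4 * z2))) by ring.
      eapply is_lim_seq_ext; [|exact L4]; intros n; simpl; ring.
    + apply pow_nonzero; lra.
  - rewrite Ev; clear v Ev EP.
    assert (M22 := mult_bounds _ _ _ _ _ _ B2 B2 ltac:(lra) ltac:(lra)).
    assert (M222 := mult_bounds _ _ _ _ _ _ M22 B2 ltac:(lra) ltac:(lra)).
    assert (M2222 := mult_bounds _ _ _ _ _ _ M22 M22 ltac:(lra) ltac:(lra)).
    assert (M32 := mult_bounds _ _ _ _ _ _ B3 B2 ltac:(lra) ltac:(lra)).
    assert (M33 := mult_bounds _ _ _ _ _ _ B3 B3 ltac:(lra) ltac:(lra)).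
    assert (M332 := mult_bounds _ _ _ _ _ _ M33 B2 ltac:(lra) ltac:(lra)).
    assert (M53 := mult_bounds _ _ _ _ _ _ B5 B3 ltac:(lra) ltac:(lra)).
    assert (D : 0.420263732606 <= 7 - 4 * z2 <= 0.420263732608) by lra.
    assert (D2 := mult_bounds _ _ _ _ _ _ D D ltac:(lra) ltac:(lra)).
    assert (D4 := mult_bounds _ _ _ _ _ _ D2 D2 ltac:(lra) ltac:(lra)).
    replace ((7 - 4 * z2) ^ 4)
      with ((7 - 4 * z2) * (7 - 4 * z2) * ((7 - 4 * z2) * (7 - 4 * z2))) by ring.
    set (d := (7 - 4 * z2) * (7 - 4 * z2) * ((7 - 4 * z2) * (7 - 4 * z2))) in *.
    (* The true value is 398464973.99; the target allows for an error of about 90. *)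
    assert (Hn : 398464900 <= num <= 398465060) by (unfold num; lra).
    assert (Hd : 0 < 14883750 * d) by lra.
    split.
    + apply Rmult_le_reg_r with (14883750 * d); [easy|].
      replace (num / (14883750 * d) * (14883750 * d)) with num by (field; lra); lra.
    + apply Rmult_lt_reg_r with (14883750 * d); [easy|].
      replace (num / (14883750 * d) * (14883750 * d)) with num by (field; lra); lra.
Qed.
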